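(* The two-parameter quantum group $U_{r,s}(\mathfrak{sl}_\infty)$ can be realized as the Drinfeld double of its Hopf subalgebras $B=U^{\ge0}_{r,s}(\mathfrak{sl}_\infty)$ and $(B')^{coop}=U^{\le0}_{r,s}(\mathfrak{sl}_\infty)$; that is, there is an isomorphism of Hopf algebras $$U_{r,s}(\mathfrak{sl}_\infty)\cong D(B,(B')^{coop}).$$
   Context: $\mathbb{N}=\{1,2,3,\dots\}$, and $\mathbb{Q}(r,s)$ is the field of rational functions in two independent variables $r,s$. On the free abelian group with basis $\alpha_i$ ($i\in\mathbb{N}$) let $\langle-,-\rangle$ be the bilinear form with $\langle i,j\rangle:=\langle\alpha_i,\alpha_j\rangle$ equal to $1$ if $i=j$, $-1$ if $j=i+1$, and $0$ otherwise. $U_{r,s}(\mathfrak{sl}_\infty)$ is the unital associative $\mathbb{Q}(r,s)$-algebra generated by $e_i,f_i,w_i^{\pm1},w_i'^{\pm1}$ ($i\in\mathbb{N}$) subject to the relations: - all $w_i^{\pm1},w_j'^{\pm1}$ commute with each other, $w_i^{\pm1}w_i^{\mp1}=1=w_i'^{\pm1}w_i'^{\mp1}$; - $w_ie_j=r^{\langle j,i\rangle}s^{-\langle i,j\rangle}e_jw_i$, $\;w_i'e_j=r^{-\langle i,j\rangle}s^{\langle j,i\rangle}e_jw_i'$; - $w_if_j=r^{-\langle j,i\rangle}s^{\langle i,j\rangle}f_jw_i$, $\;w_i'f_j=r^{\langle i,j\rangle}s^{-\langle j,i\rangle}f_jw_i'$; - $e_if_j-f_je_i=\delta_{i,j}\dfrac{w_i-w_i'}{r-s}$;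 - $e_ie_j-e_je_i=f_if_j-f_jf_i=0$ for $|i-j|>1$; - $e_i^2e_{i+1}-(r+s)e_ie_{i+1}e_i+rs\,e_{i+1}e_i^2=0$, $\;e_ie_{i+1}^2-(r+s)e_{i+1}e_ie_{i+1}+rs\,e_{i+1}^2e_i=0$; - $f_i^2f_{i+1}-(r^{-1}+s^{-1})f_if_{i+1}f_i+(rs)^{-1}f_{i+1}f_i^2=0$, $\;f_if_{i+1}^2-(r^{-1}+s^{-1})f_{i+1}f_if_{i+1}+(rs)^{-1}f_{i+1}^2f_i=0$. It is a Hopf algebra with $w_i,w_i'$ group-like, $\Delta(e_i)=e_i\otimes1+w_i\otimes e_i$, $\Delta(f_i)=1\otimes f_i+f_i\otimes w_i'$, $\epsilon(e_i)=\epsilon(f_i)=0$, $S(e_i)=-w_i^{-1}e_i$, $S(f_i)=-f_iw_i'^{-1}$. $U^{\ge0}_{r,s}(\mathfrak{sl}_\infty)$ (resp. $U^{\le0}_{r,s}(\mathfrak{sl}_\infty)$) is the Hopf subalgebra generated by all $e_i,w_i^{\pm1}$ (resp. all $f_i,w_i'^{\pm1}$). $B=U^{\ge0}_{r,s}(\mathfrak{sl}_\infty)$, and $B'$ is the algebra $U^{\le0}_{r,s}(\mathfrak{sl}_\infty)$ equipped with the opposite comultiplication, so $(B')^{coop}=U^{\le0}_{r,s}(\mathfrak{sl}_\infty)$ as a Hopf algebra. A Hopf pairing of Hopf algebras $H',H$ is a bilinear form $(\,,):H'\times H\to\mathbb{Q}(r,s)$ with $(1,h)=\epsilon_H(h)$,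 $(h',1)=\epsilon_{H'}(h')$, $(h',hk)=\sum(h'_{(1)},h)(h'_{(2)},k)$, $(h'k',h)=\sum(h',h_{(1)})(k',h_{(2)})$. There is a unique Hopf pairing $B'\times B\to\mathbb{Q}(r,s)$ with $(f_i,e_j)=\dfrac{\delta_{i,j}}{s-r}$, $(w_i',w_j)=r^{\langle i,j\rangle}s^{-\langle j,i\rangle}$ and value zero on all other pairs of generators; this pairing is used. The Drinfeld double $D(B,(B')^{coop})$ is the Hopf algebra whose underlying coalgebra is the tensor product coalgebra $B\otimes (B')^{coop}$ and whose product is $$(a\otimes f)(a'\otimes f')=\sum\bigl(S(f_{(1)}),a'_{(1)}\bigr)\bigl(f_{(3)},a'_{(3)}\bigr)\,aa'_{(2)}\otimes f_{(2)}f',$$ for $a,a'\in B$, $f,f'\in(B')^{coop}$, where the coproducts and antipode of $f$ are those of $(B')^{coop}$. *)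

(* Defs.v *)
From HB Require Import structures.
From mathcomp Require Import all_boot all_order all_algebra generic_quotient ring_quotient.
From mathcomp Require Import boolp finmap.
From mathcomp Require Import monalg.

Set Implicit Arguments.
Unset Strict Implicit.
Unset Printing Implicit Defensive.

Import GRing.Theory.
Local Open Scope ring_scope.
Local Open Scope quotient_scope.

Section LinearQuotient.
Variables (K : fieldType) (V : lmodType K) (X : V -> Prop).

Inductive lspan : V -> Prop :=
| lspan0 : lspan 0
| lspan_lin c x y of lspan x & lspan y : lspan (c *: x + y)
| lspan_gen x of X x : lspan x.

Definition lspanb (x : V) : bool := `[< lspan x >].

Lemma lspanP x : reflect (lspan x) (x \in lspanb).
Proof. exact: asboolP. Qed.

Lemma lspanb_submod : GRing.submod_closed lspanb.
Proof.
split; first by apply/lspanP; constructor.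
by move=> c x y /lspanP ? /lspanP ?; apply/lspanP; constructor.
Qed.

HB.instance Definition _ := GRing.isZmodClosed.Build V lspanb
  (GRing.submod_closedB lspanb_submod).

Lemma lspanZ c x : lspan x -> lspan (c *: x).
Proof. by move=> Xx; rewrite -[_ *: _]addr0; apply: lspan_lin => //; constructor. Qed.

Definition lquot := Quotient.quot (GRing.ZmodClosed.clone V lspanb _).

HB.instance Definition _ := EqQuotient.on lquot.
HB.instance Definition _ := GRing.Zmodule.on lquot.

Definition lpi (x : V) : lquot := \pi_lquot x.

Lemma lpi_eq x y : lspan (x - y) <-> lpi x = lpi y.
Proof.
split; first by move=> /lspanP Xxy; apply/eqP; rewrite -Quotient.idealrBE.
by move/eqP; rewrite -Quotient.idealrBE => /lspanP.
Qed.

Lemma lpi_repr (q : lquot) : lpi (repr q) = q.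
Proof. exact: reprK. Qed.

Lemma lpiD x y : lpi (x + y) = lpi x + lpi y.
Proof. by rewrite /lpi !piE. Qed.

Lemma lpi0 : lpi 0 = 0.
Proof. by rewrite /lpi !piE. Qed.

Definition lquot_scale (c : K) (q : lquot) : lquot := lpi (c *: repr q).

Lemma lquot_scale_pi c x : lquot_scale c (lpi x) = lpi (c *: x).
Proof.
apply/lpi_eq; rewrite -scalerBr; apply: lspanZ; apply/lpi_eq.
exact: lpi_repr.
Qed.

Lemma lquot_scaleA a b q :
  lquot_scale a (lquot_scale b q) = lquot_scale (a * b) q.
Proof. by rewrite -[q]lpi_repr !lquot_scale_pi scalerA. Qed.

Lemma lquot_scale1 : left_id 1 lquot_scale.
Proof. by move=> q; rewrite -[q]lpi_repr !lquot_scale_pi scale1r. Qed.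

Lemma lquot_scaleDr : right_distributive lquot_scale +%R.
Proof.
move=> c q1 q2; rewrite -[q1]lpi_repr -[q2]lpi_repr -lpiD !lquot_scale_pi.
by rewrite scalerDr lpiD.
Qed.

Lemma lquot_scaleDl q : {morph lquot_scale^~ q : a b / a + b}.
Proof.
by move=> a b; rewrite -[q]lpi_repr !lquot_scale_pi scalerDl lpiD.
Qed.

HB.instance Definition _ := GRing.Zmodule_isLmodule.Build K lquot
  lquot_scaleA lquot_scale1 lquot_scaleDr lquot_scaleDl.

Lemma lpi_linear : linear lpi.
Proof. by move=> c x y; rewrite lpiD -lquot_scale_pi. Qed.

HB.instance Definition _ := GRing.isLinear.Build K V lquot _ lpi lpi_linear.

End LinearQuotient.

Definition is_bilinear (K : fieldType) (A B C : lmodType K) (f : A -> B -> C) :=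
  (forall b, linear (f^~ b)) /\ (forall a, linear (f a)).

Section Tensor.
Variables (K : fieldType) (A B : lmodType K).
Local Notation F := {malg K[(A * B)%type]}.

Inductive tensor_relator : F -> Prop :=
| tensor_rel_l c a a' b :
    tensor_relator (<< (c *: a + a', b) >> - (c *: << (a, b) >> + << (a', b) >>))
| tensor_rel_r c a b b' :
    tensor_relator (<< (a, c *: b + b') >> - (c *: << (a, b) >> + << (a, b') >>)).

Definition tensor := lquot tensor_relator.
HB.instance Definition _ := GRing.Lmodule.on tensor.

Definition tens (a : A) (b : B) : tensor := lpi tensor_relator << (a, b) >>.

Lemma tens_bilinear : is_bilinear tens.
Proof.
split=> [b|a] c x y.
- apply: etrans (lpi_linear tensor_relator c << (x, b) >> << (y, b) >>).
  by apply/lpi_eq/lspan_gen; apply: tensor_rel_l.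
- apply: etrans (lpi_linear tensor_relator c << (a, x) >> << (a, y) >>).
  by apply/lpi_eq/lspan_gen; apply: tensor_rel_r.
Qed.

(* [tlift f] is the linear map with [a (x) b |-> f a b]; it is meaningful only
   when [f] is bilinear (see [tlift_tens], [tlift_linear]). *)
Definition tlift (C : lmodType K) (f : A -> B -> C) (t : tensor) : C :=
  let x := repr t in \sum_(k <- msupp x) x@_k *: f k.1 k.2.

Section Lift.
Variables (C : lmodType K) (f : A -> B -> C).
Hypothesis f_bil : is_bilinear f.

Let g (x : F) : C := \sum_(k <- msupp x) x@_k *: f k.1 k.2.

Let gEw (d : {fset A * B}) x : (msupp x `<=` d)%fset ->
  g x = \sum_(k <- d) x@_k *: f k.1 k.2.
Proof.
move=> le; rewrite /g (big_fset_incl _ le) //= => k _ /mcoeff_outdom ->.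
by rewrite scale0r.
Qed.

Let g_linear : linear g.
Proof.
move=> c x y; pose d := (msupp x `|` msupp y `|` msupp (c *: x + y))%fset.
rewrite !(@gEw d) ?fsubsetUr //; first last.
- by rewrite /d -fsetUA fsubsetUl.
- by rewrite /d fsetUAC fsubsetUr.
rewrite scaler_sumr -big_split; apply: eq_bigr => k _ /=.
by rewrite mcoeffD mcoeffZ scalerDl scalerA.
Qed.

Let gU a b : g << (a, b) >> = f a b.
Proof.
by rewrite (gEw msuppU_le) big_seq_fset1 mcoeffUU scale1r.
Qed.

Let gB x y : g (x - y) = g x - g y.
Proof. by rewrite [x - y]addrC -(scaleN1r y) g_linear scaleN1r addrC. Qed.

Let g_span x : lspan tensor_relator x -> g x = 0.
Proof.
elim=> [|c {}x y _ gx _ gy|{}x [c a a' b|c a b b']].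
- by rewrite -(subrr 0) gB subrr.
- by rewrite g_linear gx gy scaler0 addr0.
- by rewrite gB g_linear !gU f_bil.1 subrr.
- by rewrite gB g_linear !gU f_bil.2 subrr.
Qed.

Let tlift_pi x : tlift f (lpi tensor_relator x) = g x.
Proof.
apply/eqP; rewrite -subr_eq0 -gB; apply/eqP/g_span/lpi_eq; exact: lpi_repr.
Qed.

Lemma tlift_tens a b : tlift f (tens a b) = f a b.
Proof. by rewrite tlift_pi gU. Qed.

Lemma tlift_linear : linear (tlift f).
Proof.
move=> c x y; rewrite -[x]lpi_repr -[y]lpi_repr -lpi_linear !tlift_pi.
exact: g_linear.
Qed.

End Lift.

End Tensor.
Arguments tens {K A B}.


Lemma tensor_ind (K : fieldType) (A B : lmodType K) (P : tensor A B -> Prop) :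
  P 0 -> (forall x y, P x -> P y -> P (x + y)) ->
  (forall a b, P (tens a b)) -> forall t, P t.
Proof.
move=> P0 PD Pt t; rewrite -[t]lpi_repr; move: (repr t) => x {t}.
have pi0 := lpi0 (@tensor_relator K A B).
rewrite [x]monalgE; elim: (finmap.enum_fset _) => [|[a b] s IHs].
  by rewrite big_nil pi0.
rewrite big_cons lpiD; apply: PD => //.
have -> : lpi (@tensor_relator K A B) << x@_(a, b) *g (a, b) >>
    = tens (x@_(a, b) *: a) b; last exact: Pt.
have tZ := (tens_bilinear A B).1 b (x@_(a, b)) a 0.
have t0 : tens (0 : A) b = 0.
  have := (tens_bilinear A B).1 b (-1) 0 0.
  by rewrite scaleN1r oppr0 addr0 scaleN1r addNr.
rewrite addr0 t0 addr0 in tZ; apply: etrans (esym tZ).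
have lZ := lpi_linear (@tensor_relator K A B) (x@_(a, b)) << (a, b) >> 0.
rewrite pi0 !addr0 in lZ; apply: etrans lZ; congr (lpi _ _).
by apply/malgP => k; rewrite mcoeffZ !mcoeffU mulrnAr mulr1.
Qed.

Section TensorMaps.
Variable K : fieldType.
Implicit Types A B C : lmodType K.

Definition tmap A B A' B' (f : A -> A') (g : B -> B') : tensor A B -> tensor A' B' :=
  tlift (fun a b => tens (f a) (g b)).

Definition tassoc A B C : tensor (tensor A B) C -> tensor A (tensor B C) :=
  tlift (fun t c => tlift (fun a b => tens a (tens b c)) t).

Definition tswap A B : tensor A B -> tensor B A := tlift (fun a b => tens b a).

Definition tmul A B (mA : A -> A -> A) (mB : B -> B -> B) (x y : tensor A B) :=
  tlift (fun a b => tlift (fun a' b' => tens (mA a a') (mB b b')) y) x.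

Definition tlift3 A B C D (f : A -> B -> C -> D : lmodType K)
    (t : tensor (tensor A B) C) : D :=
  tlift (fun u c => tlift (fun a b => f a b c) u) t.

End TensorMaps.

Section Hopf.
Variable K : fieldType.

(* The multiplication is a field, rather than being taken from an [algType]
   structure, because the double puts a multiplication on [tensor V V'] which is
   not that of the tensor product of algebras. *)
Record bialg_data (V : lmodType K) := BialgData {
  bmul : V -> V -> V;
  bone : V;
  bcomul : V -> tensor V V;
  bcounit : V -> K^o }.

Record is_bialgebra (V : lmodType K) (H : bialg_data V) : Prop := IsBialgebra {
  bmul_bilinear : is_bilinear (bmul H);
  bmulA : associative (bmul H);
  bmul1x : left_id (bone H) (bmul H);
  bmulx1 : right_id (bone H) (bmul H);
  bcomul_linear : linear (bcomul H);
  bcounit_linear : linear (bcounit H);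
  bcoassoc x : tassoc (tmap (bcomul H) id (bcomul H x)) = tmap id (bcomul H) (bcomul H x);
  bcounitl x : tlift (fun x1 x2 => bcounit H x1 *: x2) (bcomul H x) = x;
  bcounitr x : tlift (fun x1 x2 => bcounit H x2 *: x1) (bcomul H x) = x;
  bcomulM x y :
    bcomul H (bmul H x y) = tmul (bmul H) (bmul H) (bcomul H x) (bcomul H y);
  bcomul1 : bcomul H (bone H) = tens (bone H) (bone H);
  bcounitM x y : bcounit H (bmul H x y) = bcounit H x * bcounit H y;
  bcounit1 : bcounit H (bone H) = 1 }.

Record hopf_data (V : lmodType K) := HopfData {
  hopf_bialg :> bialg_data V;
  antipode : V -> V }.

Record is_hopf (V : lmodType K) (H : hopf_data V) : Prop := IsHopf {
  hopf_is_bialgebra : is_bialgebra H;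
  antipode_linear : linear (antipode H);
  antipodel x :
    tlift (fun x1 x2 => bmul H (antipode H x1) x2) (bcomul H x) = bcounit H x *: bone H;
  antipoder x :
    tlift (fun x1 x2 => bmul H x1 (antipode H x2)) (bcomul H x) = bcounit H x *: bone H }.

Record hopf_on (A : algType K) := HopfOn {
  hopf_on_data :> hopf_data A;
  hopf_on_mul : forall x y, bmul hopf_on_data x y = x * y;
  hopf_on_one : bone hopf_on_data = 1;
  hopf_on_is_hopf : is_hopf hopf_on_data }.

Record hopf_morphism (V V' : lmodType K) (H : hopf_data V) (H' : hopf_data V')
    (phi : V -> V') : Prop := HopfMorphism {
  hopf_mor_linear : linear phi;
  hopf_morM x y : phi (bmul H x y) = bmul H' (phi x) (phi y);
  hopf_mor1 : phi (bone H) = bone H';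
  hopf_mor_comul x : bcomul H' (phi x) = tmap phi phi (bcomul H x);
  hopf_mor_counit x : bcounit H' (phi x) = bcounit H x;
  hopf_mor_antipode x : phi (antipode H x) = antipode H' (phi x) }.

Definition hopf_isomorphic (V V' : lmodType K) (H : hopf_data V) (H' : hopf_data V') :=
  exists2 phi : V -> V', bijective phi & hopf_morphism H H' phi.

Definition coop (V : lmodType K) (H : bialg_data V) : bialg_data V :=
  BialgData (bmul H) (bone H) (fun x => tswap (bcomul H x)) (bcounit H).

Record hopf_pairing (V' V : lmodType K) (H' : bialg_data V') (H : bialg_data V)
    (p : V' -> V -> K^o) : Prop := HopfPairing {
  pairing_bilinear : is_bilinear p;
  pairing1l x : p (bone H') x = bcounit H x;
  pairing1r x' : p x' (bone H) = bcounit H' x';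
  pairingMr x' x y :
    p x' (bmul H x y) = tlift (fun x'1 x'2 => p x'1 x * p x'2 y : K^o) (bcomul H' x');
  pairingMl x' y' x :
    p (bmul H' x' y') x = tlift (fun x1 x2 => p x' x1 * p y' x2 : K^o) (bcomul H x) }.

Definition bcomul3 (V : lmodType K) (H : bialg_data V) (x : V) :
    tensor (tensor V V) V := tmap (bcomul H) id (bcomul H x).

Section Double.
Variables (V V' : lmodType K) (H : hopf_data V) (H' : hopf_data V').
Variable p : V' -> V -> K^o.

Definition double_mul_pure (a : V) (f : V') (b : V) (g : V') : tensor V V' :=
  tlift3 (fun b1 b2 b3 =>
    tlift3 (fun f1 f2 f3 =>
      (p (antipode H' f1) b1 * p f3 b3 : K) *: tens (bmul H a b2) (bmul H' f2 g))
    (bcomul3 H' f)) (bcomul3 H b).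

Definition double_mul (x y : tensor V V') : tensor V V' :=
  tlift (fun a f => tlift (fun b g => double_mul_pure a f b g) y) x.

Definition double_comul (x : tensor V V') : tensor (tensor V V') (tensor V V') :=
  tlift (fun a f =>
    tlift (fun a1 a2 =>
      tlift (fun f1 f2 => tens (tens a1 f1) (tens a2 f2)) (bcomul H' f)) (bcomul H a)) x.

Definition double_counit (x : tensor V V') : K^o :=
  tlift (fun a f => bcounit H a * bcounit H' f : K^o) x.

(* Here [H'] plays the role of (B')^coop: [p] is a pairing of [coop H'] with [H]. *)
Definition drinfeld_double : bialg_data (tensor V V') :=
  BialgData double_mul (tens (bone H) (bone H')) double_comul double_counit.

End Double.
End Hopf.

Section GeneratedSubalgebra.
Variables (K : fieldType) (A : algType K) (X : A -> Prop).

Inductive subalg : A -> Prop :=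
| subalg1 : subalg 1
| subalg_lin c x y of subalg x & subalg y : subalg (c *: x + y)
| subalgM x y of subalg x & subalg y : subalg (x * y)
| subalg_gen x of X x : subalg x.

Definition subalgb (x : A) : bool := `[< subalg x >].

Lemma subalgP x : reflect (subalg x) (x \in subalgb).
Proof. exact: asboolP. Qed.

Lemma subalgb_closed : GRing.subalg_closed subalgb.
Proof.
split; first by apply/subalgP; constructor.
- by move=> c x y /subalgP ? /subalgP ?; apply/subalgP; constructor.
- by move=> x y /subalgP ? /subalgP ?; apply/subalgP; apply: subalgM.
Qed.

HB.instance Definition _ := GRing.isSubalgClosed.Build K A subalgb subalgb_closed.

Record subalg_of := SubalgOf { subalg_val :> A; _ : subalg_val \in subalgb }.

HB.instance Definition _ := [isSub for subalg_val].
HB.instance Definition _ := [Choice of subalg_of by <:].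
HB.instance Definition _ := [SubChoice_isSubAlgebra of subalg_of by <:].

Definition subalg_mem x (Xx : X x) : subalg_of :=
  SubalgOf (introT (subalgP x) (subalg_gen Xx)).

End GeneratedSubalgebra.

(* The index set is [nat], [i : nat] standing for the index i + 1 of {1, 2, ...}. *)
Definition form (i j : nat) : int :=
  if j == i then 1 else if j == i.+1 then -1 else 0.

Inductive gen :=
| GenE of nat | GenF of nat
| GenW of nat | GenWinv of nat
| GenW' of nat | GenW'inv of nat.

Definition gen_encode (g : gen) : nat * nat :=
  match g with
  | GenE i => (0, i) | GenF i => (1, i)
  | GenW i => (2, i) | GenWinv i => (3, i)
  | GenW' i => (4, i) | GenW'inv i => (5, i)
  end%N.
Definition gen_decode (c : nat * nat) : gen :=
  match c with
  | (0, i) => GenE i | (1, i) => GenF i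
  | (2, i) => GenW i | (3, i) => GenWinv i
  | (4, i) => GenW' i | (_, i) => GenW'inv i
  end%N.
Lemma gen_encodeK : cancel gen_encode gen_decode. Proof. by case. Qed.
HB.instance Definition _ := Countable.copy gen (can_type gen_encodeK).

Definition is_torus_gen (g : gen) : bool :=
  match g with GenE _ | GenF _ => false | _ => true end.

Lemma malg_scaleAr (R : comNzRingType) (M : monomType) (c : R) (x y : {malg R[M]}) :
  c *: (x * y) = x * (c *: y).
Proof.
apply/malgP => k; rewrite mcoeffZ mcoeffMl.
rewrite (mcoeffMlw _ (fsubset_refl _) (msuppZ_le c y)) mulr_sumr.
apply: eq_bigr => k1 _; rewrite mulr_sumr; apply: eq_bigr => k2 _.
by rewrite mcoeffZ mulrnAr mulrCA.
Qed.

Definition free_alg (K : fieldType) (X : choiceType) := {malg K[{fmonom X}]}.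
HB.instance Definition _ (K : fieldType) (X : choiceType) := GRing.Lalgebra.on (free_alg K X).
HB.instance Definition _ (K : fieldType) (X : choiceType) := GRing.Lalgebra_isAlgebra.Build K (free_alg K X)
  (@malg_scaleAr K {fmonom X}).

Section Presentation.
Variables (K : fieldType) (F : algType K) (rel : F -> F -> Prop).

(* The two-sided ideal generated by the relations [a = b], [rel a b], is the
   span of these. *)
Inductive ideal_gen : F -> Prop :=
| IdealGen u a b v of rel a b : ideal_gen (u * (a - b) * v).

Lemma ideal_mull u a : lspan ideal_gen a -> lspan ideal_gen (u * a).
Proof.
elim=> [|c x y _ Ix _ Iy|_ [u' x y v xy]].
- by rewrite mulr0; apply: lspan0.
- by rewrite mulrDr -scalerAr; apply: lspan_lin.
- by rewrite mulrA (mulrA u); apply: lspan_gen; apply: IdealGen.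
Qed.

Lemma ideal_mulr u a : lspan ideal_gen a -> lspan ideal_gen (a * u).
Proof.
elim=> [|c x y _ Ix _ Iy|_ [u' x y v xy]].
- by rewrite mul0r; apply: lspan0.
- by rewrite mulrDl -scalerAl; apply: lspan_lin.
- by rewrite -(mulrA _ v); apply: lspan_gen; apply: IdealGen.
Qed.

Definition presented := lquot ideal_gen.
HB.instance Definition _ := GRing.Lmodule.on presented.

Definition presented_pi : F -> presented := lpi ideal_gen.
Local Notation pi := presented_pi.

Lemma presented_pi_eq a b : lspan ideal_gen (a - b) <-> pi a = pi b.
Proof. exact: lpi_eq. Qed.

Lemma presented_pi0 : pi 0 = 0.
Proof. exact: lpi0. Qed.

Lemma presented_piD a b : pi (a + b) = pi a + pi b.
Proof. exact: lpiD. Qed.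

Lemma presented_piZ (c : K) a : pi (c *: a) = c *: pi a.
Proof. exact/esym/lquot_scale_pi. Qed.

Lemma presented_surj (q : presented) : exists x, q = pi x.
Proof. by exists (repr q); rewrite /pi lpi_repr. Qed.

Definition presented_mul (x y : presented) : presented := pi (repr x * repr y).

Lemma presented_mul_pi x y : presented_mul (pi x) (pi y) = pi (x * y).
Proof.
have reprB (z : F) : lspan ideal_gen (repr (pi z) - z) by apply/lpi_eq/lpi_repr.
apply/lpi_eq; set x' := repr _; set y' := repr _.
have -> : x' * y' - x * y = 1 *: ((x' - x) * y') + x * (y' - y).
  by rewrite scale1r mulrBl mulrBr addrA subrK.
apply: lspan_lin; first exact/ideal_mulr/reprB.
exact/ideal_mull/reprB.
Qed.

Lemma presented_mulA : associative presented_mul.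
Proof.
move=> x y z.
have [[a ->] [b ->] [c ->]] :=
  And3 (presented_surj x) (presented_surj y) (presented_surj z).
by rewrite !presented_mul_pi mulrA.
Qed.

Lemma presented_mul1x : left_id (pi 1) presented_mul.
Proof. by move=> x; have [a ->] := presented_surj x; rewrite presented_mul_pi mul1r. Qed.

Lemma presented_mulx1 : right_id (pi 1) presented_mul.
Proof. by move=> x; have [a ->] := presented_surj x; rewrite presented_mul_pi mulr1. Qed.

Lemma presented_mulDl : left_distributive presented_mul +%R.
Proof.
move=> x y z.
have [[a ->] [b ->] [c ->]] :=
  And3 (presented_surj x) (presented_surj y) (presented_surj z).
by rewrite -presented_piD !presented_mul_pi mulrDl presented_piD.
Qed.

Lemma presented_mulDr : right_distributive presented_mul +%R.
Proof.
move=> x y z.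
have [[a ->] [b ->] [c ->]] :=
  And3 (presented_surj x) (presented_surj y) (presented_surj z).
by rewrite -presented_piD !presented_mul_pi mulrDr presented_piD.
Qed.

Lemma presented_scaleAl (c : K) (x y : presented) :
  c *: presented_mul x y = presented_mul (c *: x) y.
Proof.
have [[a ->] [b ->]] := conj (presented_surj x) (presented_surj y).
by rewrite -presented_piZ !presented_mul_pi -presented_piZ scalerAl.
Qed.

Lemma presented_scaleAr (c : K) (x y : presented) :
  c *: presented_mul x y = presented_mul x (c *: y).
Proof.
have [[a ->] [b ->]] := conj (presented_surj x) (presented_surj y).
by rewrite -presented_piZ !presented_mul_pi -presented_piZ scalerAr.
Qed.

End Presentation.

Section Urs.
Variables (K : fieldType) (r s : K).

Section Relations.
Variables (A : algType K) (x : gen -> A).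
Let e i := x (GenE i).
Let f i := x (GenF i).
Let w i := x (GenW i).
Let wV i := x (GenWinv i).
Let w' i := x (GenW' i).
Let w'V i := x (GenW'inv i).

(* [Urs_rel a b] : [a = b] is one of the defining relations, the generators
   being evaluated in [A] through [x]. *)
Inductive Urs_rel : A -> A -> Prop :=
| rel_torus g h of is_torus_gen g & is_torus_gen h : Urs_rel (x g * x h) (x h * x g)
| rel_w_wV i : Urs_rel (w i * wV i) 1
| rel_wV_w i : Urs_rel (wV i * w i) 1
| rel_w'_w'V i : Urs_rel (w' i * w'V i) 1
| rel_w'V_w' i : Urs_rel (w'V i * w' i) 1
| rel_w_e i j :
    Urs_rel (w i * e j) ((r ^ form j i * s ^ (- form i j)) *: (e j * w i))
| rel_w'_e i j :
    Urs_rel (w' i * e j) ((r ^ (- form i j) * s ^ form j i) *: (e j * w' i))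
| rel_w_f i j :
    Urs_rel (w i * f j) ((r ^ (- form j i) * s ^ form i j) *: (f j * w i))
| rel_w'_f i j :
    Urs_rel (w' i * f j) ((r ^ form i j * s ^ (- form j i)) *: (f j * w' i))
| rel_e_f i j :
    Urs_rel (e i * f j - f j * e i)
            ((i == j)%:R *: ((r - s)^-1 *: (w i - w' i)))
| rel_e_far i j of (i.+1 < j)%N || (j.+1 < i)%N : Urs_rel (e i * e j - e j * e i) 0
| rel_f_far i j of (i.+1 < j)%N || (j.+1 < i)%N : Urs_rel (f i * f j - f j * f i) 0
| rel_serre_e1 i :
    Urs_rel (e i ^+ 2 * e i.+1 - (r + s) *: (e i * e i.+1 * e i)
             + (r * s) *: (e i.+1 * e i ^+ 2)) 0
| rel_serre_e2 i :
    Urs_rel (e i * e i.+1 ^+ 2 - (r + s) *: (e i.+1 * e i * e i.+1)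
             + (r * s) *: (e i.+1 ^+ 2 * e i)) 0
| rel_serre_f1 i :
    Urs_rel (f i ^+ 2 * f i.+1 - (r^-1 + s^-1) *: (f i * f i.+1 * f i)
             + (r * s)^-1 *: (f i.+1 * f i ^+ 2)) 0
| rel_serre_f2 i :
    Urs_rel (f i * f i.+1 ^+ 2 - (r^-1 + s^-1) *: (f i.+1 * f i * f i.+1)
             + (r * s)^-1 *: (f i.+1 ^+ 2 * f i)) 0.

Lemma Urs_rel_counit (eps : A -> K) :
    linear_for *%R eps -> monoid_morphism eps ->
    (forall g, eps (x g) = (is_torus_gen g)%:R) ->
  forall a b, Urs_rel a b -> eps a = eps b.
Proof.
move=> eps_lin [eps1 epsM] eps_gen.
have epsB a b : eps (a - b) = eps a - eps b.
  by rewrite addrC -(scaleN1r b) eps_lin mulN1r addrC.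
have eps0 : eps 0 = 0 by rewrite -(subrr 0) epsB subrr.
have epsZ c a : eps (c *: a) = c * eps a by rewrite -[_ *: _]addr0 eps_lin eps0 addr0.
have epsD a b : eps (a + b) = eps a + eps b by rewrite -(scale1r a) eps_lin mul1r scale1r.
have epsN a : eps (- a) = - eps a by rewrite -sub0r epsB eps0 sub0r.
pose eE := (epsZ, epsN, epsD, epsM, eps1, eps0, eps_gen, expr2).
have eqs := (mulr0, mul0r, mulr1, mul1r, addr0, subrr, subr0, oppr0).
by move=> a b; case=> *; rewrite !eE /= ?eqs // mulrC.
Qed.

End Relations.


Local Notation F := (free_alg K gen).
Definition free_gen (g : gen) : F := << fmu g >>.

Definition Urs := presented (Urs_rel free_gen).
HB.instance Definition _ := GRing.Lmodule.on Urs.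

Section Nontrivial.

Let h (m : {fmonom gen}) : K := \prod_(g <- m : seq gen) (is_torus_gen g)%:R.

Let h_morph : mmorphism h.
Proof. by split=> [x y|]; rewrite /h ?fmM ?big_cat // fm1 big_nil. Qed.

HB.instance Definition _ := isMultiplicative.Build {fmonom gen} K h h_morph.

Let eps : F -> K := mmap idfun h.

Let epsM : monoid_morphism eps.
Proof. by split=> [|a b]; [exact: rmorph1|exact: rmorphM]. Qed.

Let epsZ : linear_for *%R eps.
Proof. by move=> c a b; rewrite /eps mmapD mmapZ. Qed.

Let eps_gen g : eps (free_gen g) = (is_torus_gen g)%:R.
Proof. by rewrite /eps mmapU mul1r /h fmU big_seq1. Qed.

Lemma Urs_oner_neq0 : presented_pi (Urs_rel free_gen) 1 != 0.
Proof.
apply/eqP; rewrite -presented_pi0 => /presented_pi_eq; rewrite subr0.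
suff eps_ideal a : lspan (ideal_gen (Urs_rel free_gen)) a -> eps a = 0.
  by move/eps_ideal/eqP; rewrite epsM.1 oner_eq0.
have epsD a' b' : eps (a' + b') = eps a' + eps b' := mmapD _ _.
have epsB a' b' : eps (a' - b') = eps a' - eps b' := mmapB _ _.
elim=> [|c x y _ ex _ ey|_ [u x y v xy]].
- exact: mmap0.
- by rewrite epsZ ex ey mulr0 addr0.
- by rewrite !epsM.2 epsB (Urs_rel_counit epsZ epsM eps_gen xy) subrr mulr0 mul0r.
Qed.

End Nontrivial.

HB.instance Definition _ := GRing.Zmodule_isNzRing.Build Urs
  (@presented_mulA _ _ (Urs_rel free_gen)) (@presented_mul1x _ _ (Urs_rel free_gen))
  (@presented_mulx1 _ _ (Urs_rel free_gen)) (@presented_mulDl _ _ (Urs_rel free_gen))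
  (@presented_mulDr _ _ (Urs_rel free_gen)) Urs_oner_neq0.
HB.instance Definition _ := GRing.Lmodule_isLalgebra.Build K Urs
  (@presented_scaleAl _ _ (Urs_rel free_gen)).
HB.instance Definition _ := GRing.Lalgebra_isAlgebra.Build K Urs
  (@presented_scaleAr _ _ (Urs_rel free_gen)).

Definition Ugen (g : gen) : Urs := presented_pi (Urs_rel free_gen) (free_gen g).

Definition e (i : nat) : Urs := Ugen (GenE i).
Definition f (i : nat) : Urs := Ugen (GenF i).
Definition w (i : nat) : Urs := Ugen (GenW i).
Definition wV (i : nat) : Urs := Ugen (GenWinv i).
Definition w' (i : nat) : Urs := Ugen (GenW' i).
Definition w'V (i : nat) : Urs := Ugen (GenW'inv i).

Record Urs_hopf_spec (H : hopf_data Urs) : Prop := UrsHopfSpec {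
  comul_w i : bcomul H (w i) = tens (w i) (w i);
  comul_w' i : bcomul H (w' i) = tens (w' i) (w' i);
  comul_e i : bcomul H (e i) = tens (e i) 1 + tens (w i) (e i);
  comul_f i : bcomul H (f i) = tens 1 (f i) + tens (f i) (w' i);
  counit_w i : bcounit H (w i) = 1;
  counit_w' i : bcounit H (w' i) = 1;
  counit_e i : bcounit H (e i) = 0;
  counit_f i : bcounit H (f i) = 0;
  antipode_e i : antipode H (e i) = - (wV i * e i);
  antipode_f i : antipode H (f i) = - (f i * w'V i) }.

Inductive Uge0_gen : Urs -> Prop :=
| Uge0_e i : Uge0_gen (e i)
| Uge0_w i : Uge0_gen (w i)
| Uge0_wV i : Uge0_gen (wV i).

Inductive Ule0_gen : Urs -> Prop :=
| Ule0_f i : Ule0_gen (f i)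
| Ule0_w' i : Ule0_gen (w' i)
| Ule0_w'V i : Ule0_gen (w'V i).

Definition Uge0 := subalg_of Uge0_gen.
Definition Ule0 := subalg_of Ule0_gen.
HB.instance Definition _ := GRing.Algebra.on Uge0.
HB.instance Definition _ := GRing.Algebra.on Ule0.

Definition Uge0_val (x : Uge0) : Urs := subalg_val x.
Definition Ule0_val (x : Ule0) : Urs := subalg_val x.

(* The values of the pairing on w_i^{-1} and w'_i^{-1} follow from these. *)
Record Urs_pairing_spec (p : Ule0 -> Uge0 -> K^o) : Prop := UrsPairingSpec {
  pairing_f_e i j :
    p (subalg_mem (Ule0_f i)) (subalg_mem (Uge0_e j)) = (i == j)%:R / (s - r);
  pairing_w'_w i j :
    p (subalg_mem (Ule0_w' i)) (subalg_mem (Uge0_w j)) =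
      r ^ form i j * s ^ (- form j i);
  pairing_f_w i j : p (subalg_mem (Ule0_f i)) (subalg_mem (Uge0_w j)) = 0;
  pairing_w'_e i j : p (subalg_mem (Ule0_w' i)) (subalg_mem (Uge0_e j)) = 0 }.

End Urs.

(* Q(r, s) as the fraction field of Q[r][s]. *)
Definition Qrs := {fraction {poly {poly rat}}}.
HB.instance Definition _ := GRing.Field.on Qrs.
Definition r : Qrs := tofrac ('X%:P).
Definition s : Qrs := tofrac 'X.

(* Main.v *)
Require Import Defs.
From HB Require Import structures.
From mathcomp Require Import all_boot all_order all_algebra.
From mathcomp Require Import boolp classical_sets monalg.

(* Let psi : B (x) B' -> U be the multiplication a (x) f |-> a f. In the double,
   (a (x) f) (b (x) g) is the sum of the a (f1 . b . f3) (x) f2 g, where f1 and f3 act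
   on b through the pairing; since these actions commute and are compatible with the
   products, the double is an associative algebra. The elements e_i (x) 1, w_i (x) 1,
   1 (x) f_i, 1 (x) w'_i satisfy the relations of U, whence an algebra map phi from U
   to the double, and phi o psi is the identity. Moreover psi is onto, as its image is
   stable under left multiplication by the generators of U. So phi and psi are
   inverse bijections; psi is a coalgebra map because the comultiplication of U is
   multiplicative, and the Hopf structure of U, including its antipode, can be
   transported to the double along phi. *)

Set Implicit Arguments.
Unset Strict Implicit.
Unset Printing Implicit Defensive.

Import GRing.Theory.
Local Open Scope ring_scope.

(** * Sweedler sums *)

Create HintDb lin discriminated.
#[export] Hint Constants Opaque : lin.

Section LinearLemmas.
Variable K : fieldType.
Implicit Types A B C D : lmodType K.

Lemma lin_id A : linear (fun x : A => x). Proof. by []. Qed.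

Lemma lin_comp A B C (g : B -> C) (f : A -> B) :
  linear g -> linear f -> linear (fun x => g (f x)).
Proof. by move=> gl fl c x y; rewrite fl gl. Qed.

Lemma lin_bil_l A B C D (f : A -> B -> C) b (u : D -> A) :
  is_bilinear f -> linear u -> linear (fun x => f (u x) b).
Proof. by move=> fl ul c x y; rewrite ul fl.1. Qed.

Lemma lin_bil_r A B C D (f : A -> B -> C) a (u : D -> B) :
  is_bilinear f -> linear u -> linear (fun x => f a (u x)).
Proof. by move=> fl ul c x y; rewrite ul fl.2. Qed.

Lemma lin_tlift_arg A B C D (f : A -> B -> C) (t : D -> tensor A B) :
  is_bilinear f -> linear t -> linear (fun x => tlift f (t x)).
Proof. by move=> fl tl c x y; rewrite tl tlift_linear. Qed.

Lemma lin_tlift A B C (f : A -> B -> C) : is_bilinear f -> linear (tlift f).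
Proof. by move=> fl c x y; rewrite tlift_linear. Qed.

Lemma lin_tlift_fun A B C D (f : D -> A -> B -> C) (t : tensor A B) :
  (forall a b, linear (fun x => f x a b)) -> linear (fun x => tlift (f x) t).
Proof.
move=> fl c x y; rewrite /tlift scaler_sumr -big_split; apply: eq_bigr => k _ /=.
by rewrite fl scalerDr !scalerA mulrC.
Qed.

Lemma lin_scale_r A B k (u : A -> B) : linear u -> linear (fun x => k *: u x).
Proof. by move=> ul c x y; rewrite ul scalerDr !scalerA mulrC. Qed.

Lemma lin_scale_l A B (v : B) (u : A -> K^o) : linear u -> linear (fun x => (u x : K) *: v).
Proof. by move=> ul c x y; rewrite ul scalerDl scalerA. Qed.

Lemma lin_mul_r A k (u : A -> K^o) : linear u -> linear (fun x => k * u x : K^o).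
Proof. exact: lin_scale_r. Qed.

Lemma lin_mul_l A k (u : A -> K^o) : linear u -> linear (fun x => u x * k : K^o).
Proof. by move=> ul c x y; rewrite ul mulrDl -scalerAl. Qed.

Lemma lin_algmul_r A (B : algType K) k (u : A -> B) : linear u -> linear (fun x => k * u x).
Proof. by move=> ul c x y; rewrite ul mulrDr -scalerAr. Qed.

Lemma lin_algmul_l A (B : algType K) k (u : A -> B) : linear u -> linear (fun x => u x * k).
Proof. by move=> ul c x y; rewrite ul mulrDl -scalerAl. Qed.

Section Elementary.
Variables (A B : lmodType K) (f : A -> B).
Hypothesis fl : linear f.
Lemma linr0 : f 0 = 0.
Proof. by have := fl (-1) 0 0; rewrite scaleN1r oppr0 addr0 scaleN1r addNr. Qed.
Lemma linrZ c x : f (c *: x) = c *: f x.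
Proof. by rewrite -[c *: x]addr0 fl linr0 addr0. Qed.
Lemma linrD x y : f (x + y) = f x + f y.
Proof. by rewrite -{1}[x]scale1r fl scale1r. Qed.
Lemma linrN x : f (- x) = - f x.
Proof. by rewrite -scaleN1r linrZ scaleN1r. Qed.
End Elementary.

Lemma tens_ext A B C (f g : tensor A B -> C) : linear f -> linear g ->
  (forall a b, f (tens a b) = g (tens a b)) -> f =1 g.
Proof.
move=> fl gl fg; apply: tensor_ind => [|x y fx fy|//].
- by rewrite !linr0.
- by rewrite (linrD fl) (linrD gl) fx fy.
Qed.

Definition is_trilinear A B C D (f : A -> B -> C -> D) :=
  [/\ forall b c, linear (fun a => f a b c), forall a c, linear (fun b => f a b c)
    & forall a b, linear (f a b)].

Section Trilinear.
Variables (A B C D E : lmodType K) (f : A -> B -> C -> D).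
Hypothesis fl : is_trilinear f.
Lemma lin_tri1 (u : E -> A) b c : linear u -> linear (fun x => f (u x) b c).
Proof. by case: fl => fl1 _ _ ul k x y; rewrite ul fl1. Qed.
Lemma lin_tri2 a (u : E -> B) c : linear u -> linear (fun x => f a (u x) c).
Proof. by case: fl => _ fl2 _ ul k x y; rewrite ul fl2. Qed.
Lemma lin_tri3 a b (u : E -> C) : linear u -> linear (fun x => f a b (u x)).
Proof. by case: fl => _ _ fl3 ul k x y; rewrite ul fl3. Qed.
End Trilinear.

End LinearLemmas.

#[export] Hint Extern 1 (is_bilinear (@tens _ _ _)) => exact: tens_bilinear : lin.

(* In the patterns of [lin], a metavariable may capture the bound variable
   [lin_z]: the captured term is then ill-scoped, so that it has no type. *)
Ltac closed t := let T := type of t in idtac.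

Ltac lin :=
  lazymatch goal with
  | |- is_bilinear (fun lin_z => _) => split=> ? /=; lin
  | |- is_bilinear _ => first [solve [eauto 2 with lin nocore] | split=> ? /=; lin]
  | |- is_trilinear (fun lin_z => _) => split=> ? ? /=; lin
  | |- is_trilinear _ => first [assumption | split=> ? ? /=; lin]
  | |- GRing.linear_for _ (fun lin_z => lin_z) => exact: lin_id
  | |- GRing.linear_for _ (fun lin_z => tlift _ ?t) =>
      tryif closed t then apply: lin_tlift_fun => ? ? /=; lin
      else apply: lin_tlift_arg; lin
  | |- GRing.linear_for _ (tlift ?f) => apply: lin_tlift; lin
  | |- GRing.linear_for _ (fun lin_z => ?k *: _) =>
      tryif closed k then apply: lin_scale_r; lin else apply: lin_scale_l; lin
  | |- GRing.linear_for _ (fun lin_z => ?k * _) =>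
      tryif closed k then first [apply: lin_mul_r | apply: lin_algmul_r]; lin
      else first [apply: lin_mul_l | apply: lin_algmul_l]; lin
  | |- GRing.linear_for _ (fun lin_z => _) =>
      first
      [ match goal with |- GRing.linear_for _ (fun lin_z => ?f (@?u lin_z) ?b ?c) =>
          closed f; closed b; closed c;
          apply: (@lin_tri1 _ _ _ _ _ _ f _ u b c); [solve [eauto 2 with lin nocore] | lin] end
      | match goal with |- GRing.linear_for _ (fun lin_z => ?f ?a (@?u lin_z) ?c) =>
          closed f; closed a; closed c;
          apply: (@lin_tri2 _ _ _ _ _ _ f _ a u c); [solve [eauto 2 with lin nocore] | lin] end
      | match goal with |- GRing.linear_for _ (fun lin_z => ?f ?a ?b (@?u lin_z)) =>
          closed f; closed a; closed b;
          apply: (@lin_tri3 _ _ _ _ _ _ f _ a b u); [solve [eauto 2 with lin nocore] | lin] end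
      | match goal with |- GRing.linear_for _ (fun lin_z => ?f (@?u lin_z) ?b) =>
          closed f; closed b;
          apply: (@lin_bil_l _ _ _ _ _ f b u); [solve [eauto 2 with lin nocore] | lin] end
      | match goal with |- GRing.linear_for _ (fun lin_z => ?f ?a (@?u lin_z)) =>
          closed f; closed a;
          apply: (@lin_bil_r _ _ _ _ _ f a u); [solve [eauto 2 with lin nocore] | lin] end
      | match goal with |- GRing.linear_for _ (fun lin_z => ?f (@?u lin_z)) =>
          closed f;
          apply: (@lin_comp _ _ _ _ f u); [solve [eauto 2 with lin nocore] | lin] end ]
  | |- GRing.linear_for _ ?f =>
      first
      [ solve [eauto 2 with lin nocore]
      | lazymatch f with ?g ?a ?b => apply: (@lin_tri3 _ _ _ _ _ _ g _ a b) end;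
        [solve [eauto 2 with lin nocore] | exact: lin_id]
      | lazymatch f with ?g ?a => apply: (@lin_bil_r _ _ _ _ _ g a) end;
        [solve [eauto 2 with lin nocore] | exact: lin_id] ]
  end.

Section TensorLemmas.
Variable K : fieldType.
Implicit Types A B C D : lmodType K.

Lemma lin_out A B C D (g : C -> D) (f : A -> B -> C) t : linear g ->
  g (tlift f t) = tlift (fun a b => g (f a b)) t.
Proof.
move=> gl; rewrite /tlift (big_morph g (linrD gl) (linr0 gl)).
by apply: eq_bigr => k _; rewrite (linrZ gl).
Qed.

Lemma tlift_exchange A B A' B' C (f : A -> B -> A' -> B' -> C) t t' :
  tlift (fun a b => tlift (f a b) t') t =
  tlift (fun a' b' => tlift (fun a b => f a b a' b') t) t'.
Proof.
rewrite /tlift; under eq_bigr do rewrite scaler_sumr.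
rewrite exchange_big; apply: eq_bigr => k' _; rewrite scaler_sumr.
by apply: eq_bigr => k _; rewrite !scalerA mulrC.
Qed.

Lemma tliftD A B C (f : A -> B -> C) t u : is_bilinear f ->
  tlift f (t + u) = tlift f t + tlift f u.
Proof. by move=> fl; apply: (linrD (lin_tlift fl)). Qed.

Lemma tlift_scale A B C (f : A -> B -> C) k t :
  tlift (fun a b => k *: f a b) t = k *: tlift f t.
Proof. by rewrite (lin_out _ _ (g := fun x => k *: x)) //; lin. Qed.

Lemma eq_tlift A B C (f g : A -> B -> C) t :
  (forall a b, f a b = g a b) -> tlift f t = tlift g t.
Proof. by move=> fg; congr tlift; do 2! apply/funext => ?. Qed.

Lemma tlift_tlift A B A' B' C (f : A' -> B' -> C) (g : A -> B -> tensor A' B') t :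
  is_bilinear f -> tlift f (tlift g t) = tlift (fun a b => tlift f (g a b)) t.
Proof. by move=> fl; apply: lin_out; lin. Qed.

Lemma tlift_tmap A B A' B' C (g : A -> A') (h : B -> B') (f : A' -> B' -> C) t :
  is_bilinear f -> tlift f (tmap g h t) = tlift (fun a b => f (g a) (h b)) t.
Proof.
move=> fl; rewrite /tmap tlift_tlift //.
by apply: eq_tlift => a b; rewrite tlift_tens.
Qed.

Lemma tlift_id A B (t : tensor A B) : tlift tens t = t.
Proof.
elim/tensor_ind: t => [|x y fx fy|a b]; last by rewrite tlift_tens //; lin.
- by rewrite linr0 //; lin.
- by rewrite linrD ?fx ?fy //; lin.
Qed.

End TensorLemmas.

#[export] Hint Extern 1 (is_bilinear (@bmul _ _ _)) =>
  (apply: bmul_bilinear; solve [eauto 3 with lin nocore]) : lin.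
#[export] Hint Extern 1 (GRing.linear_for _ (@bcomul _ _ _)) =>
  (apply: bcomul_linear; solve [eauto 3 with lin nocore]) : lin.
#[export] Hint Extern 1 (GRing.linear_for _ (@bcounit _ _ _)) =>
  (apply: bcounit_linear; solve [eauto 3 with lin nocore]) : lin.
#[export] Hint Extern 1 (GRing.linear_for _ (@antipode _ _ _)) =>
  (apply: antipode_linear; solve [eauto 3 with lin nocore]) : lin.
#[export] Hint Extern 1 (is_bialgebra _) => assumption : lin.
#[export] Hint Extern 1 (is_hopf _) => assumption : lin.
#[export] Hint Extern 2 (is_bialgebra _) =>
  (apply: hopf_is_bialgebra; assumption) : lin.
#[export] Hint Extern 1 (GRing.linear_for _ _) => eassumption : lin.
#[export] Hint Extern 1 (is_trilinear _) => eassumption : lin.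
#[export] Hint Extern 1 (is_bilinear _) => eassumption : lin.

(* Sweedler's notation: [sw H x (fun x1 x2 => E)] is the sum of the [E] over
   [bcomul H x], written as a sum of [x1 (x) x2]; it is meaningful only when [E] is
   bilinear in [x1] and [x2]. *)
Notation sw H x F := (tlift F (bcomul H x)).

Section Sweedler.
Variables (K : fieldType) (V : lmodType K).

Section Bialgebra.
Variable H : bialg_data V.
Hypothesis Hb : is_bialgebra H.
Local Notation "x ** y" := (bmul H x y) (at level 40, left associativity).
Implicit Type C : lmodType K.

Lemma sw_coassoc C (F : V -> V -> V -> C) x : is_trilinear F ->
  sw H x (fun u c => sw H u (fun a b => F a b c)) = sw H x (fun a u => sw H u (F a)).
Proof.
move=> Ft.
have := congr1 (tlift (fun a => tlift (F a))) (bcoassoc Hb x).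
rewrite tlift_tmap; last by lin.
move=> <-.
rewrite /tassoc tlift_tlift; last by lin.
rewrite (tlift_tmap (bcomul H) id); last by lin.
apply: eq_tlift => u c; rewrite tlift_tlift; last by lin.
by apply: eq_tlift => a b; rewrite !tlift_tens //; lin.
Qed.

Lemma tlift3_bcomul3 C (F : V -> V -> V -> C) x : is_trilinear F ->
  tlift3 F (bcomul3 H x) = sw H x (fun u c => sw H u (fun a b => F a b c)).
Proof. by move=> Ft; rewrite /tlift3 (tlift_tmap (bcomul H) id) //; lin. Qed.

Lemma sw_counitl C (G : V -> C) x : linear G ->
  sw H x (fun a b => (bcounit H a : K) *: G b) = G x.
Proof.
move=> Gl; rewrite -{2}(bcounitl Hb x) (lin_out _ _ Gl).
by apply: eq_tlift => a b; rewrite (linrZ Gl).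
Qed.

Lemma sw_counitr C (G : V -> C) x : linear G ->
  sw H x (fun a b => (bcounit H b : K) *: G a) = G x.
Proof.
move=> Gl; rewrite -{2}(bcounitr Hb x) (lin_out _ _ Gl).
by apply: eq_tlift => a b; rewrite (linrZ Gl).
Qed.

Lemma sw_one C (F : V -> V -> C) : is_bilinear F -> sw H (bone H) F = F (bone H) (bone H).
Proof. by move=> Fl; rewrite (bcomul1 Hb) tlift_tens. Qed.

Lemma sw_mul C (F : V -> V -> C) x y : is_bilinear F ->
  sw H (x ** y) F = sw H x (fun a b => sw H y (fun c d => F (a ** c) (b ** d))).
Proof.
move=> Fl; rewrite (bcomulM Hb) /tmul tlift_tlift //; apply: eq_tlift => a b.
by rewrite tlift_tlift //; apply: eq_tlift => c d; rewrite tlift_tens.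
Qed.

End Bialgebra.

Section HopfAlgebra.
Variable H : hopf_data V.
Hypothesis Hh : is_hopf H.
Local Notation S := (antipode H).
Local Notation "x ** y" := (bmul H x y) (at level 40, left associativity).
Implicit Type C : lmodType K.

Lemma sw_antipodel C (G : V -> C) x : linear G ->
  sw H x (fun a b => G (antipode H a ** b)) = (bcounit H x : K) *: G (bone H).
Proof. by move=> Gl; rewrite -(lin_out _ _ Gl) (antipodel Hh) (linrZ Gl). Qed.

Lemma sw_antipoder C (G : V -> C) x : linear G ->
  sw H x (fun a b => G (a ** antipode H b)) = (bcounit H x : K) *: G (bone H).
Proof. by move=> Gl; rewrite -(lin_out _ _ Gl) (antipoder Hh) (linrZ Gl). Qed.

(* Both sides are convolution inverses of the multiplication. *)
Lemma antipodeM x y : S (x ** y) = S y ** S x.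
Proof.
have Hb := hopf_is_bialgebra Hh.
have [[mA m1x] mx1] := (bmulA Hb, bmul1x Hb, bmulx1 Hb).
transitivity (sw H x (fun u x3 => sw H y (fun v y3 =>
    sw H (u ** v) (fun a b => S a ** b ** (S y3 ** S x3))))); last first.
  rewrite -(sw_counitl Hb (G := fun x => S y ** S x)); last by lin.
  apply: eq_tlift => u x3.
  rewrite -(sw_counitl Hb (G := fun y => S y ** S x3)); last by lin.
  rewrite -tlift_scale; apply: eq_tlift => v y3.
  rewrite (sw_antipodel (G := fun z => z ** (S y3 ** S x3))); last by lin.
  by rewrite (bcounitM Hb) m1x scalerA.
transitivity (sw H x (fun x1 u => sw H u (fun x2 x3 => sw H y (fun y1 v =>
    sw H v (fun y2 y3 => S (x1 ** y1) ** ((x2 ** (y2 ** S y3)) ** S x3)))))).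
  rewrite -(sw_counitr Hb (G := fun x => S (x ** y))); last by lin.
  apply: eq_tlift => x1 u.
  rewrite -[S (x1 ** y)]mx1.
  rewrite -(sw_antipoder _ (G := fun z => S (x1 ** y) ** z)); last by lin.
  apply: eq_tlift => x2 x3.
  rewrite -(sw_counitr Hb (G := fun y => S (x1 ** y) ** (x2 ** S x3))); last by lin.
  apply: eq_tlift => y1 v.
  rewrite (sw_antipoder _ (G := fun z => S (x1 ** y1) ** (x2 ** z ** S x3))); last by lin.
  by rewrite mx1.
rewrite -(sw_coassoc Hb (F := fun x1 x2 x3 => sw H y (fun y1 v => sw H v (fun y2 y3 =>
  S (x1 ** y1) ** ((x2 ** (y2 ** S y3)) ** S x3))))); last by lin.
apply: eq_tlift => u x3 /=.
transitivity (sw H u (fun x1 x2 => sw H y (fun v y3 => sw H v (fun y1 y2 =>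
    S (x1 ** y1) ** (x2 ** (y2 ** S y3) ** S x3))))).
  apply: eq_tlift => x1 x2; rewrite (sw_coassoc Hb (F := fun y1 y2 y3 =>
    S (x1 ** y1) ** (x2 ** (y2 ** S y3) ** S x3))) //; lin.
rewrite tlift_exchange; apply: eq_tlift => v y3; rewrite (sw_mul Hb); last by lin.
by do 2! apply: eq_tlift => ? ?; rewrite !mA.
Qed.

Lemma antipode1 : S (bone H) = bone H.
Proof.
have Hb := hopf_is_bialgebra Hh.
have := antipodel Hh (bone H); rewrite sw_one //; last by lin.
by rewrite (bmulx1 Hb) => ->; rewrite (bcounit1 Hb) scale1r.
Qed.

Lemma counit_antipode x : bcounit H (S x) = bcounit H x.
Proof.
have Hb := hopf_is_bialgebra Hh.
rewrite -(sw_counitr Hb (G := fun x => bcounit H (S x))); last by lin.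
transitivity (sw H x (fun a b => bcounit H (S a ** b))).
  by apply: eq_tlift => a b; rewrite (bcounitM Hb) mulrC.
by rewrite (sw_antipodel (G := bcounit H)) ?(bcounit1 Hb) ?[LHS]mulr1 //; lin.
Qed.

End HopfAlgebra.
End Sweedler.

(** * The multiplication of the Drinfeld double *)

Section Double.
Variables (K : fieldType) (V V' : lmodType K) (H : hopf_data V) (H' : hopf_data V').
Variable p : V' -> V -> K^o.
Hypotheses (Hh : is_hopf H) (Hh' : is_hopf H') (pp : hopf_pairing (coop H') H p).
Local Notation "x ** y" := (bmul H x y) (at level 40, left associativity).
Local Notation "x *' y" := (bmul H' x y) (at level 40, left associativity).
Local Notation S' := (antipode H').
Let Hb := hopf_is_bialgebra Hh.
Let Hb' := hopf_is_bialgebra Hh'.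

Let p_bil : is_bilinear p := pairing_bilinear pp.
#[local] Hint Resolve p_bil : lin.

Lemma pairing_mulr f a b : p f (a ** b) = sw H' f (fun f1 f2 => p f2 a * p f1 b : K^o).
Proof.
rewrite (pairingMr pp) /= /tswap tlift_tlift; last by lin.
by apply: eq_tlift => f1 f2; rewrite tlift_tens //; lin.
Qed.

Lemma pairing_mull f f' b : p (f *' f') b = sw H b (fun b1 b2 => p f b1 * p f' b2 : K^o).
Proof. exact: (pairingMl pp). Qed.

Definition lact f b : V := sw H b (fun b1 b2 => (p f b2 : K) *: b1).
Definition ract0 f b : V := sw H b (fun b1 b2 => (p f b1 : K) *: b2).

Lemma lact_bilinear : is_bilinear lact. Proof. by rewrite /lact; lin. Qed.
Lemma ract0_bilinear : is_bilinear ract0. Proof. by rewrite /ract0; lin. Qed.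
#[local] Hint Resolve lact_bilinear ract0_bilinear : lin.

Lemma lactM f f' b : lact (f *' f') b = lact f (lact f' b).
Proof.
rewrite {3}/lact (lin_out (g := lact f)); last by lin.
transitivity (sw H b (fun u b3 => sw H u (fun b1 b2 => (p f b2 * p f' b3 : K) *: b1))).
  rewrite (sw_coassoc Hb (F := fun b1 b2 b3 => (p f b2 * p f' b3 : K) *: b1)); last by lin.
  apply: eq_tlift => b1 u; rewrite pairing_mull.
  by rewrite (lin_out (g := fun k : K^o => (k : K) *: b1)) //; lin.
apply: eq_tlift => u b3; rewrite (linrZ (f := lact f)); last by lin.
by rewrite -tlift_scale; apply: eq_tlift => b1 b2; rewrite scalerA mulrC.
Qed.

Lemma ract0M f f' b : ract0 (f *' f') b = ract0 f' (ract0 f b).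
Proof.
rewrite {3}/ract0 (lin_out (g := ract0 f')); last by lin.
transitivity (sw H b (fun b1 u => sw H u (fun b2 b3 => (p f b1 * p f' b2 : K) *: b3))).
  rewrite -(sw_coassoc Hb (F := fun b1 b2 b3 => (p f b1 * p f' b2 : K) *: b3)); last by lin.
  apply: eq_tlift => u b3; rewrite pairing_mull.
  by rewrite (lin_out (g := fun k : K^o => (k : K) *: b3)) //; lin.
apply: eq_tlift => u b3; rewrite (linrZ (f := ract0 f')); last by lin.
by rewrite -tlift_scale; apply: eq_tlift => b1 b2; rewrite scalerA.
Qed.

Lemma lact_ract0 f f' b : lact f (ract0 f' b) = ract0 f' (lact f b).
Proof.
rewrite {2}/lact {1}/ract0 (lin_out (g := lact f)) ?(lin_out (g := ract0 f')); try by lin.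
transitivity (sw H b (fun b1 u => sw H u (fun b2 b3 => (p f' b1 * p f b3 : K) *: b2))).
  apply: eq_tlift => b1 u; rewrite (linrZ (f := lact f)); last by lin.
  by rewrite -tlift_scale; apply: eq_tlift => b2 b3; rewrite scalerA.
rewrite -(sw_coassoc Hb (F := fun b1 b2 b3 => (p f' b1 * p f b3 : K) *: b2)); last by lin.
apply: eq_tlift => u b3; rewrite (linrZ (f := ract0 f')); last by lin.
by rewrite -tlift_scale; apply: eq_tlift => b1 b2; rewrite scalerA mulrC.
Qed.

Lemma lact_mul2 f g a b : lact f a ** lact g b =
  sw H a (fun a1 a2 => sw H b (fun b1 b2 => (p f a2 * p g b2 : K) *: (a1 ** b1))).
Proof.
have bm := bmul_bilinear Hb.
rewrite /lact (lin_out (g := fun z => z ** _)); last by lin.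
apply: eq_tlift => a1 a2; rewrite (lin_out (g := fun z => _ ** z)); last by lin.
by apply: eq_tlift => b1 b2; rewrite (linrZ (bm.2 _)) (linrZ (bm.1 _)) scalerA mulrC.
Qed.

Lemma ract0_mul2 f g a b : ract0 f a ** ract0 g b =
  sw H a (fun a1 a2 => sw H b (fun b1 b2 => (p f a1 * p g b1 : K) *: (a2 ** b2))).
Proof.
have bm := bmul_bilinear Hb.
rewrite /ract0 (lin_out (g := fun z => z ** _)); last by lin.
apply: eq_tlift => a1 a2; rewrite (lin_out (g := fun z => _ ** z)); last by lin.
by apply: eq_tlift => b1 b2; rewrite (linrZ (bm.2 _)) (linrZ (bm.1 _)) scalerA mulrC.
Qed.

Lemma lact_prod f a b : lact f (a ** b) = sw H' f (fun f1 f2 => lact f2 a ** lact f1 b).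
Proof.
under [RHS]eq_tlift do rewrite lact_mul2.
rewrite tlift_exchange {1}/lact (sw_mul Hb); last by lin.
apply: eq_tlift => a1 a2; rewrite tlift_exchange; apply: eq_tlift => b1 b2.
by rewrite pairing_mulr (lin_out (g := fun k : K^o => (k : K) *: _)) //; lin.
Qed.

Lemma ract0_prod f a b : ract0 f (a ** b) = sw H' f (fun f1 f2 => ract0 f2 a ** ract0 f1 b).
Proof.
under [RHS]eq_tlift do rewrite ract0_mul2.
rewrite tlift_exchange {1}/ract0 (sw_mul Hb); last by lin.
apply: eq_tlift => a1 a2; rewrite tlift_exchange; apply: eq_tlift => b1 b2.
by rewrite pairing_mulr (lin_out (g := fun k : K^o => (k : K) *: _)) //; lin.
Qed.

Lemma lact_one f : lact f (bone H) = (bcounit H' f : K) *: bone H.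
Proof. by rewrite /lact sw_one ?(pairing1r pp) //; lin. Qed.

Lemma ract0_one f : ract0 f (bone H) = (bcounit H' f : K) *: bone H.
Proof. by rewrite /ract0 sw_one ?(pairing1r pp) //; lin. Qed.

Lemma one_lact b : lact (bone H') b = b.
Proof.
rewrite -[RHS](sw_counitr Hb (G := fun z => z)) //.
by apply: eq_tlift => b1 b2; rewrite (pairing1l pp).
Qed.

Lemma one_ract0 b : ract0 (bone H') b = b.
Proof.
rewrite -[RHS](sw_counitl Hb (G := fun z => z)) //.
by apply: eq_tlift => b1 b2; rewrite (pairing1l pp).
Qed.

Definition ract f b := ract0 (S' f) b.

Lemma ract_bilinear : is_bilinear ract. Proof. by rewrite /ract; lin. Qed.
#[local] Hint Resolve ract_bilinear : lin.

Lemma ractM f f' b : ract (f *' f') b = ract f (ract f' b).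
Proof. by rewrite /ract (antipodeM Hh') ract0M. Qed.

Lemma ractK f b : sw H' f (fun f1 f2 => ract0 f2 (ract f1 b)) = (bcounit H' f : K) *: b.
Proof.
rewrite -[b in RHS]one_ract0 -(sw_antipodel Hh' (G := fun z => ract0 z b)); last by lin.
by apply: eq_tlift => f1 f2; rewrite ract0M.
Qed.

Lemma ract0K f b : sw H' f (fun f1 f2 => ract f2 (ract0 f1 b)) = (bcounit H' f : K) *: b.
Proof.
rewrite -[b in RHS]one_ract0 -(sw_antipoder Hh' (G := fun z => ract0 z b)); last by lin.
by apply: eq_tlift => f1 f2; rewrite ract0M.
Qed.

(* Both sides are inverse to [ract0_prod] by [ractK] and [ract0K]. *)
Lemma ract_prod f a b : ract f (a ** b) = sw H' f (fun f1 f2 => ract f1 a ** ract f2 b).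
Proof.
pose Y f := sw H' f (fun f1 f2 => ract f1 a ** ract f2 b).
have Yl : linear Y by rewrite /Y; lin.
have XY g : sw H' g (fun g1 g2 => ract0 g2 (Y g1)) = (bcounit H' g : K) *: (a ** b).
  rewrite -(linrZ (f := fun z => z ** b)) -?ractK; last by lin.
  rewrite (lin_out (g := fun z => z ** b)); last by lin.
  transitivity (sw H' g (fun g1 u => sw H' u (fun v g4 => sw H' v (fun g2 g3 =>
      ract0 g4 (ract g1 a) ** ract0 g3 (ract g2 b))))).
    transitivity (sw H' g (fun u v => sw H' u (fun g1 g2 => sw H' v (fun g3 g4 =>
        ract0 g4 (ract g1 a) ** ract0 g3 (ract g2 b))))).
      apply: eq_tlift => u v; rewrite (lin_out (g := ract0 v)); last by lin.
      by apply: eq_tlift => g1 g2; rewrite ract0_prod.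
    rewrite (sw_coassoc Hb' (F := fun g1 g2 v => sw H' v (fun g3 g4 =>
        ract0 g4 (ract g1 a) ** ract0 g3 (ract g2 b)))); last by lin.
    apply: eq_tlift => g1 u; rewrite (sw_coassoc Hb' (F := fun g2 g3 g4 =>
        ract0 g4 (ract g1 a) ** ract0 g3 (ract g2 b))) //; lin.
  apply: eq_tlift => g1 u.
  rewrite -[RHS](sw_counitl Hb' (G := fun g4 => ract0 g4 (ract g1 a) ** b)); last by lin.
  apply: eq_tlift => v g4; rewrite -(lin_out (g := bmul H _)); last by lin.
  by rewrite ractK (linrZ ((bmul_bilinear Hb).2 _)).
rewrite -/(Y f) -(sw_counitl Hb' (G := fun f => ract f (a ** b))); last by lin.
transitivity (sw H' f (fun u f3 => sw H' u (fun f1 f2 => ract f3 (ract0 f2 (Y f1))))).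
  apply: eq_tlift => u f3; rewrite -(lin_out (g := ract f3)); last by lin.
  by rewrite XY (linrZ (f := ract f3)) //; lin.
rewrite (sw_coassoc Hb' (F := fun f1 f2 f3 => ract f3 (ract0 f2 (Y f1)))); last by lin.
rewrite -[RHS](sw_counitr Hb' (G := Y)); last by lin.
by apply: eq_tlift => f1 u; rewrite ract0K.
Qed.

Definition adact f f' b := ract f (lact f' b).

Lemma adact_trilinear : is_trilinear adact.
Proof. by rewrite /adact; lin. Qed.
#[local] Hint Resolve adact_trilinear : lin.

Lemma adactM f g f' g' b : adact (f *' g) (f' *' g') b = adact f f' (adact g g' b).
Proof. by rewrite /adact lactM ractM /ract lact_ract0. Qed.

Lemma one_adact b : adact (bone H') (bone H') b = b.
Proof. by rewrite /adact one_lact /ract (antipode1 Hh') one_ract0. Qed.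

Lemma adact_one f f' :
  adact f f' (bone H) = (bcounit H' f * bcounit H' f' : K) *: bone H.
Proof.
rewrite /adact lact_one (linrZ (f := ract f)); last by lin.
by rewrite /ract ract0_one (counit_antipode Hh') scalerA mulrC.
Qed.

Lemma adact_prod f f' a b : adact f f' (a ** b) =
  sw H' f (fun f1 f2 => sw H' f' (fun f'1 f'2 => adact f1 f'2 a ** adact f2 f'1 b)).
Proof.
rewrite /adact lact_prod (lin_out (g := ract f)); last by lin.
rewrite tlift_exchange.
by apply: eq_tlift => f'1 f'2; rewrite ract_prod.
Qed.

Lemma adactE f f' b : adact f f' b =
  sw H b (fun u b3 => sw H u (fun b1 b2 => (p (S' f) b1 * p f' b3 : K) *: b2)).
Proof.
rewrite /adact {1}/lact (lin_out (g := ract f)); last by lin.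
apply: eq_tlift => u b3; rewrite (linrZ (f := ract f)); last by lin.
by rewrite -tlift_scale; apply: eq_tlift => b1 b2; rewrite scalerA mulrC.
Qed.

Local Notation pure a f b g := (sw H' f (fun u f3 => sw H' u (fun f1 f2 =>
  tens (a ** adact f1 f3 b) (f2 *' g)))).

Lemma double_mul_pureE a f b g : double_mul_pure H H' p a f b g = pure a f b g.
Proof.
transitivity (tlift3 (fun b1 b2 b3 => sw H' f (fun u f3 => sw H' u (fun f1 f2 =>
    (p (S' f1) b1 * p f3 b3 : K) *: tens (a ** b2) (f2 *' g)))) (bcomul3 H b)).
  apply: (congr1 (fun F => tlift3 F (bcomul3 H b))); do 3! apply/funext => ?.
  by rewrite tlift3_bcomul3; [|lin].
rewrite tlift3_bcomul3; last by lin.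
under eq_tlift => u b3 do rewrite tlift_exchange.
rewrite tlift_exchange; apply: eq_tlift => u f3.
under eq_tlift => v b3 do rewrite tlift_exchange.
rewrite tlift_exchange; apply: eq_tlift => f1 f2.
rewrite adactE (lin_out (g := fun b => tens (a ** b) (f2 *' g))); last by lin.
apply: eq_tlift => v b3; rewrite (lin_out (g := fun b => tens (a ** b) (f2 *' g))); last by lin.
apply: eq_tlift => b1 b2.
by rewrite (linrZ (f := fun b => tens (a ** b) (f2 *' g))) //; lin.
Qed.

Lemma double_mulE x y :
  double_mul H H' p x y = tlift (fun a f => tlift (fun b g => pure a f b g) y) x.
Proof. by do 2! apply: eq_tlift => ? ?; rewrite double_mul_pureE. Qed.

Lemma double_mul_tens a f b g : double_mul H H' p (tens a f) (tens b g) = pure a f b g.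
Proof. by rewrite double_mulE !tlift_tens //; lin. Qed.

Local Notation D := (tensor V V').
Local Notation dmul := (double_mul H H' p).

Lemma double_mul_bilinear : is_bilinear dmul.
Proof.
have -> : dmul = fun x y => tlift (fun a f => tlift (fun b g => pure a f b g) y) x.
  by do 2! apply/funext => ?; exact: double_mulE.
lin.
Qed.
#[local] Hint Resolve double_mul_bilinear : lin.

Lemma double_mulA : associative dmul.
Proof.
have [mA mA'] := (bmulA Hb, bmulA Hb').
move=> x y z; move: x.
apply: tens_ext; [by lin | by lin | move=> a f]; move: y.
apply: tens_ext; [by lin | by lin | move=> b g]; move: z.
apply: tens_ext; [by lin | by lin | move=> c h].
Local Notation T a b c g h f1 f2 f3 f4 f5 := (sw H' g (fun g' g3 => sw H' g' (fun g1 g2 =>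
   tens (a ** (adact f1 f5 b ** adact (f2 *' g1) (f4 *' g3) c)) (f3 *' (g2 *' h))))).
transitivity (sw H' f (fun u v => sw H' u (fun f12 f3 => sw H' f12 (fun f1 f2 =>
    sw H' v (fun f4 f5 => T a b c g h f1 f2 f3 f4 f5))))).
  rewrite !double_mul_tens (lin_out (g := dmul _)); last by lin.
  transitivity (sw H' f (fun u v => sw H' u (fun f12 f3 => sw H' g (fun g' g3 =>
      sw H' g' (fun g1 g2 => tens (a ** adact f12 v (b ** adact g1 g3 c))
                                  (f3 *' (g2 *' h))))))).
    under [RHS]eq_tlift => u v.
      rewrite tlift_exchange; under eq_tlift do rewrite tlift_exchange; over.
    rewrite [RHS]tlift_exchange; apply: eq_tlift => g' g3.
    rewrite [RHS]tlift_exchange (lin_out (g := dmul _)); last by lin.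
    by apply: eq_tlift => g1 g2; rewrite double_mul_tens.
  apply: eq_tlift => u v; apply: eq_tlift => f12 f3.
  under [RHS]eq_tlift => f1 f2.
    rewrite tlift_exchange; under eq_tlift do rewrite tlift_exchange; over.
  rewrite [RHS]tlift_exchange; apply: eq_tlift => g' g3.
  rewrite [RHS]tlift_exchange; apply: eq_tlift => g1 g2.
  rewrite adact_prod (lin_out (g := fun z => tens (a ** z) _)); last by lin.
  apply: eq_tlift => f1 f2; rewrite (lin_out (g := fun z => tens (a ** z) _)); last by lin.
  by apply: eq_tlift => f4 f5; rewrite adactM.
transitivity (sw H' f (fun u f5 => sw H' u (fun f1 v => sw H' v (fun w f4 => sw H' w (fun f2 f3 =>
    T a b c g h f1 f2 f3 f4 f5))))); last first.
  rewrite double_mul_tens (lin_out (g := dmul^~ _)); last by lin.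
  apply: eq_tlift => u f5; rewrite (lin_out (g := dmul^~ _)); last by lin.
  apply: eq_tlift => f1 v; rewrite double_mul_tens [RHS](sw_mul Hb'); last by lin.
  apply: eq_tlift => w f4.
  rewrite [LHS]tlift_exchange; apply: eq_tlift => g' g3; rewrite [RHS](sw_mul Hb'); last by lin.
  by do 2! apply: eq_tlift => ? ?; rewrite !mA !mA'.
transitivity (sw H' f (fun u f5 => sw H' u (fun v f4 => sw H' v (fun f12 f3 =>
    sw H' f12 (fun f1 f2 => T a b c g h f1 f2 f3 f4 f5))))).
  rewrite [RHS](sw_coassoc Hb' (F := fun u f4 f5 => sw H' u (fun f12 f3 => sw H' f12 (fun f1 f2 =>
    T a b c g h f1 f2 f3 f4 f5)))); last by lin.
  apply: eq_tlift => u v; rewrite [RHS]tlift_exchange.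
  by apply: eq_tlift => f12 f3; rewrite [RHS]tlift_exchange.
apply: eq_tlift => u f5.
rewrite -[RHS](sw_coassoc Hb' (F := fun f1 w f4 => sw H' w (fun f2 f3 =>
    T a b c g h f1 f2 f3 f4 f5))); last by lin.
apply: eq_tlift => v f4; rewrite [LHS](sw_coassoc Hb' (F := fun f1 f2 f3 =>
    T a b c g h f1 f2 f3 f4 f5)); [reflexivity | lin].
Qed.

Lemma double_mul_inl a b g :
  dmul (tens a (bone H')) (tens b g) = tens (a ** b) g.
Proof.
rewrite double_mul_tens !(sw_one Hb'); try by lin.
by rewrite one_adact (bmul1x Hb').
Qed.

Lemma double_mul_inr a f g : dmul (tens a f) (tens (bone H) g) = tens a (f *' g).
Proof.
rewrite double_mul_tens -[a in RHS](bmulx1 Hb).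
rewrite -[RHS](sw_counitr Hb' (G := fun f => tens (a ** bone H) (f *' g))); last by lin.
apply: eq_tlift => u f3.
rewrite -[RHS](sw_counitl Hb' (G := fun f => (bcounit H' f3 : K) *: tens (a ** bone H) (f *' g)));
  last by lin.
apply: eq_tlift => f1 f2; rewrite adact_one scalerA.
by rewrite (linrZ (f := fun z => tens (a ** z) _)) //; lin.
Qed.

Lemma double_mul1x : left_id (tens (bone H) (bone H')) dmul.
Proof.
apply: tens_ext; [by lin | by lin | move=> a f].
by rewrite double_mul_inl (bmul1x Hb).
Qed.

Lemma double_mulx1 : right_id (tens (bone H) (bone H')) dmul.
Proof.
apply: tens_ext; [by lin | by lin | move=> a f].
by rewrite double_mul_inr (bmulx1 Hb').
Qed.

Lemma double_one_neq0 : tens (bone H) (bone H') != 0.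
Proof.
have bl : is_bilinear (fun a f => bcounit H a * bcounit H' f : K^o) by lin.
apply/eqP => /(congr1 (tlift (fun a f => bcounit H a * bcounit H' f : K^o))).
rewrite tlift_tens // (linr0 (lin_tlift bl)) (bcounit1 Hb) (bcounit1 Hb') mulr1.
by move/eqP; rewrite oner_eq0.
Qed.

Let dmulDl : left_distributive dmul +%R.
Proof. by move=> x y z; rewrite (linrD (double_mul_bilinear.1 z)). Qed.

Let dmulDr : right_distributive dmul +%R.
Proof. by move=> x y z; rewrite (linrD (double_mul_bilinear.2 x)). Qed.

Let dscaleAl (c : K) x y : c *: dmul x y = dmul (c *: x) y.
Proof. by rewrite (linrZ (double_mul_bilinear.1 y)). Qed.

Let dscaleAr (c : K) x y : c *: dmul x y = dmul x (c *: y).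
Proof. by rewrite (linrZ (double_mul_bilinear.2 x)). Qed.

Definition double_alg of is_hopf H & is_hopf H' & hopf_pairing (coop H') H p := D.
Local Notation A := (double_alg Hh Hh' pp).
HB.instance Definition _ := GRing.Lmodule.on A.
HB.instance Definition _ := GRing.Zmodule_isNzRing.Build A
  double_mulA double_mul1x double_mulx1 dmulDl dmulDr double_one_neq0.
HB.instance Definition _ := GRing.Lmodule_isLalgebra.Build K A dscaleAl.
HB.instance Definition _ := GRing.Lalgebra_isAlgebra.Build K A dscaleAr.

Lemma double_alg_mul (x y : A) : x * y = dmul x y.
Proof. by []. Qed.

End Double.

(** * Presentation of the quantum group and transport of structure *)

Lemma Urs_rel_morph (K : fieldType) (r s : K) (A B : algType K) (x : gen -> A)
    (phi : A -> B) : linear phi -> monoid_morphism phi ->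
  forall a b, Urs_rel r s x a b -> Urs_rel r s (fun g => phi (x g)) (phi a) (phi b).
Proof.
move=> phil [phi1 phiM]; pose y g := phi (x g).
have phiX a : phi (a ^+ 2) = phi a ^+ 2 by rewrite !expr2 phiM.
have E := (phiX, linrZ phil, linrD phil, linrN phil, phiM, phi1, linr0 phil).
move=> a b.
case=> [g h tg th|i|i|i|i|i j|i j|i j|i j|i j|i j ij|i j ij|i|i|i|i]; rewrite !E.
- exact: (rel_torus r s y tg th).
- exact: (rel_w_wV r s y i).
- exact: (rel_wV_w r s y i).
- exact: (rel_w'_w'V r s y i).
- exact: (rel_w'V_w' r s y i).
- exact: (rel_w_e r s y i j).
- exact: (rel_w'_e r s y i j).
- exact: (rel_w_f r s y i j).
- exact: (rel_w'_f r s y i j).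
- exact: (rel_e_f r s y i j).
- exact: (rel_e_far r s y ij).
- exact: (rel_f_far r s y ij).
- exact: (rel_serre_e1 r s y i).
- exact: (rel_serre_e2 r s y i).
- exact: (rel_serre_f1 r s y i).
- exact: (rel_serre_f2 r s y i).
Qed.

Lemma Urs_rel_lift (K : fieldType) (r s : K) (A B : algType K) (y : gen -> A)
    (phi : A -> B) : linear phi -> monoid_morphism phi ->
    (forall a b, Urs_rel r s y a b -> phi a = phi b) ->
  forall a b, Urs_rel r s (fun g => phi (y g)) a b -> a = b.
Proof.
move=> phil [phi1 phiM] y_rel.
have phiX a : phi (a ^+ 2) = phi a ^+ 2 by rewrite !expr2 phiM.
have E := (phiX, linrZ phil, linrD phil, linrN phil, phiM, phi1, linr0 phil).
move=> a b.
case=> [g h tg th|i|i|i|i|i j|i j|i j|i j|i j|i j ij|i j ij|i|i|i|i].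
- by have := y_rel _ _ (rel_torus r s y tg th); rewrite !E.
- by have := y_rel _ _ (rel_w_wV r s y i); rewrite !E.
- by have := y_rel _ _ (rel_wV_w r s y i); rewrite !E.
- by have := y_rel _ _ (rel_w'_w'V r s y i); rewrite !E.
- by have := y_rel _ _ (rel_w'V_w' r s y i); rewrite !E.
- by have := y_rel _ _ (rel_w_e r s y i j); rewrite !E.
- by have := y_rel _ _ (rel_w'_e r s y i j); rewrite !E.
- by have := y_rel _ _ (rel_w_f r s y i j); rewrite !E.
- by have := y_rel _ _ (rel_w'_f r s y i j); rewrite !E.
- by have := y_rel _ _ (rel_e_f r s y i j); rewrite !E.
- by have := y_rel _ _ (rel_e_far r s y ij); rewrite !E.
- by have := y_rel _ _ (rel_f_far r s y ij); rewrite !E.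
- by have := y_rel _ _ (rel_serre_e1 r s y i); rewrite !E.
- by have := y_rel _ _ (rel_serre_e2 r s y i); rewrite !E.
- by have := y_rel _ _ (rel_serre_f1 r s y i); rewrite !E.
- by have := y_rel _ _ (rel_serre_f2 r s y i); rewrite !E.
Qed.

Section UrsUniversal.
Variables (K : fieldType) (r s : K) (A : algType K) (x : gen -> A).
Hypothesis x_rel : forall a b, Urs_rel r s x a b -> a = b.

Let h (m : {fmonom gen}) : A := \prod_(g <- m : seq gen) x g.

Let h_morph : mmorphism h.
Proof. by split=> [m n|]; rewrite /h ?fmM ?big_cat // fm1 big_nil. Qed.

HB.instance Definition _ := isMultiplicative.Build {fmonom gen} A h h_morph.

Let ev : free_alg K gen -> A := mmap (in_alg A) h.

Let evM : monoid_morphism ev.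
Proof.
have [g m m'|ev1 evM] := @commr_mmap_is_multiplicative _ _ _ (in_alg A) h; last by split.
  by rewrite /GRing.comm /= mulr_algl mulr_algr.
Qed.

Let evl : linear ev.
Proof. by move=> c a b; rewrite /ev mmapD mmapZ /= mulr_algl. Qed.

Let ev_gen g : ev (free_gen K g) = x g.
Proof. by rewrite /ev mmapU /= scale1r mul1r /h fmU big_seq1. Qed.

Let ev_rel a b : Urs_rel r s (free_gen K) a b -> ev a = ev b.
Proof.
move/(Urs_rel_morph evl evM); have -> : (fun g => ev (free_gen K g)) = x by exact/funext.
exact: x_rel.
Qed.

Local Notation pi := (presented_pi (Urs_rel r s (free_gen K))).

Lemma Urs_universal : exists phi : Urs r s -> A,
  [/\ linear phi, monoid_morphism phi & forall g, phi (Ugen r s g) = x g].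
Proof.
have ev_ideal a : lspan (ideal_gen (Urs_rel r s (free_gen K))) a -> ev a = 0.
  elim=> [|c y z _ ea _ eb|_ [u a' b v ab]].
  - exact: (linr0 evl).
  - by rewrite evl ea eb scaler0 addr0.
  - by rewrite !evM.2 (linrD evl) (linrN evl) (ev_rel ab) subrr mulr0 mul0r.
pose phi (q : Urs r s) := ev (repr q).
have phiE a : phi (presented_pi (Urs_rel r s (free_gen K)) a) = ev a.
  apply/eqP; rewrite -subr_eq0 -(linrN evl) -(linrD evl); apply/eqP/ev_ideal.
  by apply/lpi_eq; exact: lpi_repr.
exists phi; split=> [c q q'||g]; last by rewrite phiE ev_gen.
- have [[a ->] [b ->]] := (presented_surj q, presented_surj q').
  by rewrite -presented_piZ -presented_piD !phiE evl.
- split; first by rewrite phiE evM.1.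
  move=> q q'; have [[a ->] [b ->]] := (presented_surj q, presented_surj q').
  have -> : (pi a : Urs r s) * pi b = pi (a * b) by exact: presented_mul_pi.
  by rewrite !phiE evM.2.
Qed.

End UrsUniversal.

Section UrsRelations.
Variables (K : fieldType) (r s : K).
Local Notation pi := (presented_pi (Urs_rel r s (free_gen K)) : _ -> Urs r s).

Lemma Urs_relP a b : Urs_rel r s (Ugen r s) a b -> a = b.
Proof.
apply: (@Urs_rel_lift _ _ _ _ _ (free_gen K) pi) => [c x y||x y xy].
- by rewrite -presented_piZ -presented_piD.
- by split=> [|x y]; [reflexivity | exact/esym/presented_mul_pi].
- apply/presented_pi_eq/lspan_gen.
  by have := IdealGen 1 1 xy; rewrite mul1r mulr1.
Qed.

End UrsRelations.

Section Transport.
Variables (K : fieldType) (V V' : lmodType K) (H : hopf_data V) (D : bialg_data V').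
Variables (phi : V -> V') (psi : V' -> V).
Hypotheses (Hh : is_hopf H) (phil : linear phi) (psil : linear psi).
Hypotheses (phiK : cancel phi psi) (psiK : cancel psi phi).
Hypotheses (phiM : forall x y, phi (bmul H x y) = bmul D (phi x) (phi y)).
Hypotheses (phi1 : phi (bone H) = bone D).
Hypotheses (phiDelta : forall x, bcomul D (phi x) = tmap phi phi (bcomul H x)).
Hypotheses (phiEps : forall x, bcounit D (phi x) = bcounit H x).
Let Hb := hopf_is_bialgebra Hh.

Let bmul_bil : is_bilinear (bmul D).
Proof.
have -> : bmul D = fun x y => phi (bmul H (psi x) (psi y)).
  by do 2! apply/funext => ?; rewrite phiM !psiK.
lin.
Qed.

Let bcomul_lin : linear (bcomul D).
Proof.
have -> : bcomul D = fun x => tmap phi phi (bcomul H (psi x)).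
  by apply/funext => ?; rewrite -phiDelta psiK.
by rewrite /tmap; lin.
Qed.

Let bcounit_lin : linear (bcounit D).
Proof.
have -> : bcounit D = fun x => bcounit H (psi x).
  by apply/funext => ?; rewrite -phiEps psiK.
lin.
Qed.

Let sw_phi (C : lmodType K) (F : V' -> V' -> C) x : is_bilinear F ->
  sw D (phi x) F = sw H x (fun a b => F (phi a) (phi b)).
Proof. by move=> Fl; rewrite phiDelta tlift_tmap. Qed.

Lemma transport_bialgebra : is_bialgebra D.
Proof.
split=> //.
- move=> x y z; rewrite -(psiK x) -(psiK y) -(psiK z) -!phiM.
  by rewrite (bmulA Hb).
- by move=> x; rewrite -(psiK x) -phi1 -phiM (bmul1x Hb).
- by move=> x; rewrite -(psiK x) -phi1 -phiM (bmulx1 Hb).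
- move=> y; rewrite -(psiK y); move: (psi y) => x.
  rewrite /tassoc /tmap tlift_tlift; last by lin.
  rewrite [LHS](sw_phi x); last by lin.
  rewrite [RHS](sw_phi x); last by lin.
  transitivity (sw H x (fun u c => sw H u (fun a b =>
      tens (phi a) (tens (phi b) (phi c))))).
    apply: eq_tlift => u c; rewrite tlift_tens; last by lin.
    by rewrite [LHS](sw_phi u); [|lin].
  rewrite (sw_coassoc Hb (F := fun a b c => tens (phi a) (tens (phi b) (phi c)))); last by lin.
  apply: eq_tlift => a u; rewrite phiDelta /tmap.
  by rewrite (lin_out (g := tens _)) //; lin.
- move=> y; rewrite -(psiK y); move: (psi y) => x.
  rewrite [LHS](sw_phi x); last by lin.
  rewrite -(sw_counitl Hb (G := phi)) //.
  by apply: eq_tlift => a b; rewrite phiEps.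
- move=> y; rewrite -(psiK y); move: (psi y) => x.
  rewrite [LHS](sw_phi x); last by lin.
  rewrite -(sw_counitr Hb (G := phi)) //.
  by apply: eq_tlift => a b; rewrite phiEps.
- move=> y z; rewrite -(psiK y) -(psiK z); move: (psi y) (psi z) => a b.
  rewrite -phiM phiDelta /tmap sw_mul //; last by lin.
  rewrite /tmul [RHS](sw_phi a); last by lin.
  apply: eq_tlift => a1 a2; rewrite [RHS](sw_phi b); last by lin.
  by apply: eq_tlift => b1 b2; rewrite !phiM.
- by rewrite -phi1 phiDelta (bcomul1 Hb) /tmap tlift_tens //; lin.
- by move=> y z; rewrite -(psiK y) -(psiK z) -phiM !phiEps (bcounitM Hb).
- by rewrite -phi1 phiEps (bcounit1 Hb).
Qed.

Lemma transport_hopf : let H' := HopfData D (phi \o antipode H \o psi) in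
  is_hopf H' /\ hopf_isomorphic H H'.
Proof.
have Db := transport_bialgebra.
split; last by exists phi; [exists psi | split=> //= x; rewrite phiK].
split=> //= [|y|y].
- by rewrite /comp; lin.
- rewrite -(psiK y); move: (psi y) => x; rewrite [LHS](sw_phi x); last by lin.
  rewrite phiEps -phi1 -(sw_antipodel Hh (G := phi)) //.
  by apply: eq_tlift => a b; rewrite phiM /= phiK.
- rewrite -(psiK y); move: (psi y) => x; rewrite [LHS](sw_phi x); last by lin.
  rewrite phiEps -phi1 -(sw_antipoder Hh (G := phi)) //.
  by apply: eq_tlift => a b; rewrite phiM /= phiK.
Qed.

End Transport.

(** * Injectivity of the tensor square of an injection *)

(* The coproduct of an element of a Hopf subalgebra is thus determined by its
   coproduct in the whole algebra. *)
Section Retraction.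
Variables (K : fieldType) (A U : lmodType K) (v : A -> U).
Hypotheses (vl : linear v) (v_inj : injective v).
Local Open Scope classical_set_scope.

Let P (C : set U) := (forall k x y, C x -> C y -> C (k *: x + y)) /\
  (forall a, C (v a) -> v a = 0).

Let exists_complement : exists C : set U, [/\ C 0, P C & forall u, exists a, C (u - v a)].
Proof.
have [C [[CL C0] Cmax]] : exists C, P C /\ forall B, C `<` B -> ~ P B.
  apply: Zorn_bigcup => F FP Ftot; split=> [k x y [C FC Cx] [D FD Dy]|a [C FC Ca]].
    have [CD|DC] := Ftot _ _ FC FD.
      by exists D => //; apply: (FP _ FD).1 => //; apply: CD.
    by exists C => //; apply: (FP _ FC).1 => //; apply: DC.
  exact: (FP _ FC).2 Ca.
have C00 : C 0.
  apply: contrapT => nC0; apply: (Cmax (C `|` [set 0])).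
    by split; [move=> x; left | move=> /(_ 0) h; apply: nC0; apply: h; right].
  have CZ k x : C x -> C (k *: x).
    by move=> Cx; rewrite -(subrK 1 k) scalerDl scale1r; apply: CL.
  split=> [k x y [Cx|->] [Cy|->]|a [/C0 //|//]].
  - by left; apply: CL.
  - by left; rewrite addr0; apply: CZ.
  - by left; rewrite scaler0 add0r.
  - by right; rewrite scaler0 addr0.
exists C; split=> // u.
apply: contrapT => nu.
pose B := [set x | exists k, C (x - k *: u)].
apply: (Cmax B).
  split=> [x Cx|BC]; first by exists 0; rewrite scale0r subr0.
  apply: nu; exists 0; rewrite (linr0 vl) subr0; apply: BC; exists 1.
  by rewrite scale1r subrr.
split=> [k x y [c Cx] [d Dy]|a [k Ca]].
  exists (k * c + d).
  have -> : k *: x + y - (k * c + d) *: u = k *: (x - c *: u) + (y - d *: u).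
    by rewrite scalerBr scalerDl scalerA opprD addrACA.
  exact: CL.
have [k0|k0] := eqVneq k 0; first by apply: C0; move: Ca; rewrite k0 scale0r subr0.
case: nu; exists (k^-1 *: a).
have -> : u - v (k^-1 *: a) = - k^-1 *: (v a - k *: u) + 0.
  by rewrite addr0 scaleNr scalerBr scalerA mulVf // scale1r opprB (linrZ vl).
exact: CL.
Qed.

Lemma linear_retraction : exists2 g : U -> A, linear g & cancel v g.
Proof.
have [C [C0 [CL Cv] CU]] := exists_complement.
have CN x : C x -> C (- x) by move=> Cx; rewrite -scaleN1r -[_ *: _]addr0; apply: CL.
have uniq u a b : C (u - v a) -> C (u - v b) -> a = b.
  move=> Ca Cb; apply: v_inj; apply/eqP; rewrite -subr_eq0; apply/eqP.
  rewrite -(linrN vl) -(linrD vl); apply: Cv; rewrite (linrD vl) (linrN vl).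
  have -> : v a - v b = -1 *: (u - v a) + (u - v b).
    by rewrite scaleN1r opprB addrA subrK.
  exact: CL.
have [g gP] := choice CU.
exists g => [k x y|a]; last by apply: uniq (gP _) _; rewrite subrr.
apply: uniq (gP _) _.
have -> : k *: x + y - v (k *: g x + g y) = k *: (x - v (g x)) + (y - v (g y)).
  by rewrite vl scalerBr opprD addrACA.
exact: CL.
Qed.

Lemma tmap_inj : injective (tmap v v).
Proof.
have [g gl vK] := linear_retraction.
apply: (can_inj (g := tmap g g)) => t.
rewrite {1}/tmap tlift_tmap; last by lin.
by rewrite -[RHS]tlift_id; apply: eq_tlift => a b; rewrite !vK.
Qed.

End Retraction.

(** * Gluing representations of the two halves *)

Section Gluing.
Variables (K : fieldType) (r s : K) (U B B' A : algType K) (x : gen -> U).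
Variables (vB : B -> U) (vB' : B' -> U) (iB : B -> A) (iB' : B' -> A).
Variables (eB wB wVB : nat -> B) (fB w'B w'VB : nat -> B').
Hypotheses (vB_inj : injective vB) (vB'_inj : injective vB').
Hypotheses (vBl : linear vB) (vBm : monoid_morphism vB).
Hypotheses (vB'l : linear vB') (vB'm : monoid_morphism vB').
Hypotheses (iBl : linear iB) (iBm : monoid_morphism iB).
Hypotheses (iB'l : linear iB') (iB'm : monoid_morphism iB').
Hypotheses (vB_e : forall i, vB (eB i) = x (GenE i)).
Hypotheses (vB_w : forall i, vB (wB i) = x (GenW i)).
Hypotheses (vB_wV : forall i, vB (wVB i) = x (GenWinv i)).
Hypotheses (vB'_f : forall i, vB' (fB i) = x (GenF i)).
Hypotheses (vB'_w' : forall i, vB' (w'B i) = x (GenW' i)).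
Hypotheses (vB'_w'V : forall i, vB' (w'VB i) = x (GenW'inv i)).
Hypotheses (x_rel : forall a b, Urs_rel r s x a b -> a = b).

Hypotheses (w'_w : forall i j, iB' (w'B i) * iB (wB j) = iB (wB j) * iB' (w'B i)).
Hypotheses (w'_e : forall i j, iB' (w'B i) * iB (eB j) =
  (r ^ (- Defs.form i j) * s ^ Defs.form j i) *: (iB (eB j) * iB' (w'B i))).
Hypotheses (w_f : forall i j, iB (wB i) * iB' (fB j) =
  (r ^ (- Defs.form j i) * s ^ Defs.form i j) *: (iB' (fB j) * iB (wB i))).
Hypotheses (e_f : forall i j, iB (eB i) * iB' (fB j) - iB' (fB j) * iB (eB i) =
  (i == j)%:R *: ((r - s)^-1 *: (iB (wB i) - iB' (w'B i)))).

Definition glue (g : gen) : A :=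
  match g with
  | GenE i => iB (eB i) | GenF i => iB' (fB i)
  | GenW i => iB (wB i) | GenWinv i => iB (wVB i)
  | GenW' i => iB' (w'B i) | GenW'inv i => iB' (w'VB i)
  end.

Let vBX a : vB (a ^+ 2) = vB a ^+ 2. Proof. by rewrite !expr2 vBm.2. Qed.
Let vB'X a : vB' (a ^+ 2) = vB' a ^+ 2. Proof. by rewrite !expr2 vB'm.2. Qed.
Let iBX a : iB (a ^+ 2) = iB a ^+ 2. Proof. by rewrite !expr2 iBm.2. Qed.
Let iB'X a : iB' (a ^+ 2) = iB' a ^+ 2. Proof. by rewrite !expr2 iB'm.2. Qed.

Let vE := (vBX, vBm.2, vBm.1, linrZ vBl, linrD vBl, linrN vBl, linr0 vBl, vB_e, vB_w, vB_wV).
Let vE' := (vB'X, vB'm.2, vB'm.1, linrZ vB'l, linrD vB'l, linrN vB'l, linr0 vB'l,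
  vB'_f, vB'_w', vB'_w'V).
Let iE := (iBX, iBm.2, iBm.1, linrZ iBl, linrD iBl, linrN iBl, linr0 iBl).
Let iE' := (iB'X, iB'm.2, iB'm.1, linrZ iB'l, linrD iB'l, linrN iB'l, linr0 iB'l).

Let relB a b : Urs_rel r s x (vB a) (vB b) -> iB a = iB b.
Proof. by move/x_rel/vB_inj ->. Qed.

Let relB' a b : Urs_rel r s x (vB' a) (vB' b) -> iB' a = iB' b.
Proof. by move/x_rel/vB'_inj ->. Qed.

Let comm_inv (a b c : A) : b * c = 1 -> c * b = 1 -> a * b = b * a -> a * c = c * a.
Proof.
by move=> bc cb ab; rewrite -[LHS]mul1r -cb -mulrA (mulrA b) -ab -!mulrA bc mulr1.
Qed.

Let w_wV i : iB (wB i) * iB (wVB i) = 1.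
Proof.
by rewrite -iBm.2 -iBm.1; apply: relB; rewrite !vE; exact: rel_w_wV.
Qed.
Let wV_w i : iB (wVB i) * iB (wB i) = 1.
Proof.
by rewrite -iBm.2 -iBm.1; apply: relB; rewrite !vE; exact: rel_wV_w.
Qed.
Let w'_w'V i : iB' (w'B i) * iB' (w'VB i) = 1.
Proof.
by rewrite -iB'm.2 -iB'm.1; apply: relB'; rewrite !vE'; exact: rel_w'_w'V.
Qed.
Let w'V_w' i : iB' (w'VB i) * iB' (w'B i) = 1.
Proof.
by rewrite -iB'm.2 -iB'm.1; apply: relB'; rewrite !vE'; exact: rel_w'V_w'.
Qed.
Let w'_wV i j : iB' (w'B i) * iB (wVB j) = iB (wVB j) * iB' (w'B i).
Proof. exact: comm_inv (w_wV j) (wV_w j) (w'_w i j). Qed.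
Let w'V_w i j : iB' (w'VB i) * iB (wB j) = iB (wB j) * iB' (w'VB i).
Proof. exact/esym/(comm_inv (w'_w'V i) (w'V_w' i))/esym/w'_w. Qed.
Let w'V_wV i j : iB' (w'VB i) * iB (wVB j) = iB (wVB j) * iB' (w'VB i).
Proof. exact: comm_inv (w_wV j) (wV_w j) (w'V_w i j). Qed.

Lemma glue_rel a b : Urs_rel r s glue a b -> a = b.
Proof.
case=> [g h tg th|i|i|i|i|i j|i j|i j|i j|i j|i j ij|i j ij|i|i|i|i] //=.
- have xt : Urs_rel r s x (x g * x h) (x h * x g) by exact: rel_torus.
  case: g h tg th xt => [i|i|i|i|i|i] [j|j|j|j|j|j] //= _ _ xt;
    rewrite ?(w'_w, w'_wV, w'V_w, w'V_wV) //.
  1-8: first [rewrite -!iBm.2; apply: relB; rewrite !vE; exact: xt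
    | rewrite -!iB'm.2; apply: relB'; rewrite !vE'; exact: xt].
- have := @relB (wB i * eB j) ((r ^ Defs.form j i * s ^ (- Defs.form i j)) *: (eB j * wB i)).
  by rewrite !iE !vE; apply; exact: rel_w_e.
- have := @relB' (w'B i * fB j) ((r ^ Defs.form i j * s ^ (- Defs.form j i)) *: (fB j * w'B i)).
  by rewrite !iE' !vE'; apply; exact: rel_w'_f.
- have := @relB (eB i * eB j - eB j * eB i) 0.
  by rewrite !iE !vE; apply; exact: rel_e_far.
- have := @relB' (fB i * fB j - fB j * fB i) 0.
  by rewrite !iE' !vE'; apply; exact: rel_f_far.
- have := @relB (eB i ^+ 2 * eB i.+1 - (r + s) *: (eB i * eB i.+1 * eB i)
             + (r * s) *: (eB i.+1 * eB i ^+ 2)) 0.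
  by rewrite !iE !vE; apply; exact: rel_serre_e1.
- have := @relB (eB i * eB i.+1 ^+ 2 - (r + s) *: (eB i.+1 * eB i * eB i.+1)
             + (r * s) *: (eB i.+1 ^+ 2 * eB i)) 0.
  by rewrite !iE !vE; apply; exact: rel_serre_e2.
- have := @relB' (fB i ^+ 2 * fB i.+1 - (r^-1 + s^-1) *: (fB i * fB i.+1 * fB i)
             + (r * s)^-1 *: (fB i.+1 * fB i ^+ 2)) 0.
  by rewrite !iE' !vE'; apply; exact: rel_serre_f1.
- have := @relB' (fB i * fB i.+1 ^+ 2 - (r^-1 + s^-1) *: (fB i.+1 * fB i * fB i.+1)
             + (r * s)^-1 *: (fB i.+1 ^+ 2 * fB i)) 0.
  by rewrite !iE' !vE'; apply; exact: rel_serre_f2.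
Qed.

End Gluing.

(** * Spanning by products of the two halves *)

Section Spanning.
Variables (K : fieldType) (r s : K) (U B B' : algType K) (x : gen -> U).
Variables (vB : B -> U) (vB' : B' -> U).
Variables (eB wB wVB : nat -> B) (fB w'B w'VB : nat -> B').
Hypotheses (vBl : linear vB) (vBm : monoid_morphism vB).
Hypotheses (vB'l : linear vB') (vB'm : monoid_morphism vB').
Hypotheses (vB_e : forall i, vB (eB i) = x (GenE i)).
Hypotheses (vB_w : forall i, vB (wB i) = x (GenW i)).
Hypotheses (vB_wV : forall i, vB (wVB i) = x (GenWinv i)).
Hypotheses (vB'_f : forall i, vB' (fB i) = x (GenF i)).
Hypotheses (vB'_w' : forall i, vB' (w'B i) = x (GenW' i)).
Hypotheses (vB'_w'V : forall i, vB' (w'VB i) = x (GenW'inv i)).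
Hypotheses (x_rel : forall a b, Urs_rel r s x a b -> a = b).
Hypotheses (r_neq0 : r != 0) (s_neq0 : s != 0).
Hypotheses (B_gen : forall b,
  subalg (fun b => [\/ exists i, b = eB i, exists i, b = wB i | exists i, b = wVB i]) b).
Hypotheses (U_gen : forall u, subalg (fun u => exists g, u = x g) u).

Local Notation psi := (tlift (fun a f => vB a * vB' f)).

Let psi_bil : is_bilinear (fun a f => vB a * vB' f).
Proof.
split=> [f|a] c y z.
- by rewrite vBl mulrDl -scalerAl.
- by rewrite vB'l mulrDr -scalerAr.
Qed.

Let Z (c : B') := c = 1 \/ exists i, [\/ c = fB i, c = w'B i | c = w'VB i].
Let W := lspan (fun u => exists2 bc, Z bc.2 & u = vB bc.1 * vB' bc.2).

Let W_gen b c : Z c -> W (vB b * vB' c).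
Proof. by move=> Zc; apply: lspan_gen; exists (b, c). Qed.

Let W_lin k u v : W u -> W v -> W (k *: u + v).
Proof. exact: lspan_lin. Qed.

Let WZ k u : W u -> W (k *: u).
Proof. by move=> Wu; rewrite -[_ *: _]addr0; apply: lspan_lin => //; exact: lspan0. Qed.

Let W_mull b u : W u -> W (vB b * u).
Proof.
elim=> [|k y z _ Wy _ Wz|_ [[b' c] Zc ->]].
- by rewrite mulr0; exact: lspan0.
- by rewrite mulrDr -scalerAr; exact: W_lin.
- by rewrite mulrA -vBm.2; exact: W_gen.
Qed.

Let w_wV i : x (GenW i) * x (GenWinv i) = 1. Proof. exact/x_rel/rel_w_wV. Qed.
Let wV_w i : x (GenWinv i) * x (GenW i) = 1. Proof. exact/x_rel/rel_wV_w. Qed.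
Let w'_w'V i : x (GenW' i) * x (GenW'inv i) = 1. Proof. exact/x_rel/rel_w'_w'V. Qed.
Let w'V_w' i : x (GenW'inv i) * x (GenW' i) = 1. Proof. exact/x_rel/rel_w'V_w'. Qed.

Let inv_skew (k : K) (a b c : U) :
  b * c = 1 -> c * b = 1 -> b * a = k *: (a * b) -> a * c = k *: (c * a).
Proof.
move=> bc cb ba; rewrite -[LHS]mul1r -cb -mulrA (mulrA b) ba.
by rewrite -scalerAl -scalerAr -!mulrA bc mulr1.
Qed.

Let skew_inv (k : K) (a b : U) : k != 0 -> a = k *: b -> b = k^-1 *: a.
Proof. by move=> k0 ->; rewrite scalerA mulVf // scale1r. Qed.

Let k_neq0 (i j : int) : r ^ i * s ^ j != 0.
Proof. by rewrite mulf_neq0 // expfz_neq0. Qed.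

Let W_mulr_gen b c : Z c ->
    [\/ exists i, b = eB i, exists i, b = wB i | exists i, b = wVB i] ->
  W (vB' c * vB b).
Proof.
have Z1 : Z 1 by left.
have Wx (k : K) b' c' : Z c' -> W (k *: (vB b' * vB' c')).
  by move=> Zc; apply/WZ/W_gen.
move=> [-> _|[i [] ->]].
- by rewrite vB'm.1 mul1r -[vB b]mulr1 -vB'm.1; apply: W_gen.
- have Zf : Z (fB i) by right; exists i; constructor.
  have Zw' : Z (w'B i) by right; exists i; constructor.
  case=> -[j ->].
  + have -> : vB' (fB i) * vB (eB j) = (-1 : K) *: ((j == i)%:R *: ((r - s)^-1 *: 
        (vB (wB j) * vB' 1 + (-1 : K) *: (vB 1 * vB' (w'B j))))) + vB (eB j) * vB' (fB i).
      rewrite vBm.1 vB'm.1 mulr1 mul1r !scaleN1r vB'_f vB_e vB_w vB'_w'.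
      by rewrite -(x_rel (rel_e_f _ _ _ _ _)) opprB subrK.
    apply: W_lin; last exact: W_gen.
    do 2! apply: WZ; rewrite -[X in X + _]scale1r.
    apply: W_lin; first exact: W_gen.
    by apply: Wx; right; exists j; constructor.
  + have := skew_inv (k_neq0 _ _) (x_rel (rel_w_f r s x j i)).
    by rewrite -vB'_f -vB_w => ->; exact: Wx.
  + have := inv_skew (w_wV j) (wV_w j) (x_rel (rel_w_f r s x j i)).
    by rewrite -vB'_f -vB_wV => ->; exact: Wx.
- have Zw' : Z (w'B i) by right; exists i; constructor.
  case=> -[j ->].
  + by rewrite vB'_w' vB_e (x_rel (rel_w'_e _ _ _ _ _)) -vB'_w' -vB_e; exact: Wx.
  + rewrite vB'_w' vB_w (x_rel (rel_torus _ _ _ _ _)) // -vB'_w' -vB_w.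
    exact: W_gen.
  + rewrite vB'_w' vB_wV (x_rel (rel_torus _ _ _ _ _)) // -vB'_w' -vB_wV.
    exact: W_gen.
- have Zw' : Z (w'VB i) by right; exists i; constructor.
  case=> -[j ->].
  + have := skew_inv (k_neq0 _ _)
      (inv_skew (w'_w'V i) (w'V_w' i) (x_rel (rel_w'_e r s x i j))).
    by rewrite -vB'_w'V -vB_e => ->; exact: Wx.
  + rewrite vB'_w'V vB_w (x_rel (rel_torus _ _ _ _ _)) // -vB'_w'V -vB_w.
    exact: W_gen.
  + rewrite vB'_w'V vB_wV (x_rel (rel_torus _ _ _ _ _)) // -vB'_w'V -vB_wV.
    exact: W_gen.
Qed.

Let W_mulr u b : W u -> W (u * vB b).
Proof.
elim: (B_gen b) u => {b} [|k a b _ Wa _ Wb|a b _ Wa _ Wb|b b_gen] u Wu.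
- by rewrite vBm.1 mulr1.
- by rewrite vBl mulrDr -scalerAr; apply: W_lin; [exact: Wa | exact: Wb].
- by rewrite vBm.2 mulrA; apply/Wb/Wa.
elim: Wu => [|k y z _ Wy _ Wz|_ [[b' c] /= Zc ->]].
- by rewrite mul0r; exact: lspan0.
- by rewrite mulrDl -scalerAl; exact: W_lin.
- by rewrite -mulrA; apply/W_mull/W_mulr_gen.
Qed.

Let img u := exists t, psi t = u.

Let img_lin k u v : img u -> img v -> img (k *: u + v).
Proof.
by move=> [t <-] [t' <-]; exists (k *: t + t'); rewrite tlift_linear.
Qed.

Let img0 : img 0. Proof. by exists 0; rewrite (linr0 (lin_tlift psi_bil)). Qed.

Let W_img u f : W u -> img (u * vB' f).
Proof.
elim=> [|k y z _ Wy _ Wz|_ [[b c] /= _ ->]].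
- by rewrite mul0r.
- by rewrite mulrDl -scalerAl; exact: img_lin.
- by exists (tens b (c * f)); rewrite tlift_tens // vB'm.2 mulrA.
Qed.

Let img_gen g u : img u -> img (x g * u).
Proof.
move=> [t <-]; elim/tensor_ind: t => [|t t' It It'|a f].
- by rewrite (linr0 (lin_tlift psi_bil)) mulr0.
- by rewrite (linrD (lin_tlift psi_bil)) mulrDr -[X in X + _]scale1r; exact: img_lin.
rewrite tlift_tens //.
have imgB b : img (vB b * (vB a * vB' f)).
  by exists (tens (b * a) f); rewrite tlift_tens // vBm.2 mulrA.
have imgB' c : Z c -> img (vB' c * (vB a * vB' f)).
  by move=> Zc; rewrite mulrA -[vB' c]mul1r -vBm.1; apply/W_img/W_mulr/W_gen.
case: g => i.
- by rewrite -vB_e.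
- by rewrite -vB'_f; apply: imgB'; right; exists i; constructor.
- by rewrite -vB_w.
- by rewrite -vB_wV.
- by rewrite -vB'_w'; apply: imgB'; right; exists i; constructor.
- by rewrite -vB'_w'V; apply: imgB'; right; exists i; constructor.
Qed.

Lemma triangular_surj u : exists t, psi t = u.
Proof.
suff imgM v : img v -> img (u * v).
  rewrite -[u]mulr1; apply: imgM; exists (tens 1 1).
  by rewrite tlift_tens // vBm.1 vB'm.1 mulr1.
elim: (U_gen u) v => {u} [|k a b _ Ia _ Ib|a b _ Ia _ Ib|_ [g ->]] v Iv.
- by rewrite mul1r.
- by rewrite mulrDl -scalerAl; apply: img_lin; [exact: Ia | exact: Ib].
- by rewrite -mulrA; apply/Ia/Ib.
- exact: img_gen.
Qed.

End Spanning.

(** * The double of the two halves *)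

(* The three algebras are variables so that unification does not unfold the
   quotients by which the actual ones are defined. *)
Section TriangularDecomposition.
Variables (K : fieldType) (r s : K) (U B B' : algType K) (x : gen -> U).
Variables (HU : hopf_on U) (HB : hopf_on B) (HB' : hopf_on B').
Variables (vB : B -> U) (vB' : B' -> U) (p : B' -> B -> K^o).
Variables (eB wB wVB : nat -> B) (fB w'B w'VB : nat -> B').
Hypotheses (HB_sub : hopf_morphism HB HU vB) (HB'_sub : hopf_morphism HB' HU vB').
Hypotheses (vB_inj : injective vB) (vB'_inj : injective vB').
Hypotheses (vB_e : forall i, vB (eB i) = x (GenE i)).
Hypotheses (vB_w : forall i, vB (wB i) = x (GenW i)).
Hypotheses (vB_wV : forall i, vB (wVB i) = x (GenWinv i)).
Hypotheses (vB'_f : forall i, vB' (fB i) = x (GenF i)).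
Hypotheses (vB'_w' : forall i, vB' (w'B i) = x (GenW' i)).
Hypotheses (vB'_w'V : forall i, vB' (w'VB i) = x (GenW'inv i)).
Hypotheses (x_rel : forall a b, Urs_rel r s x a b -> a = b).

Hypotheses (comul_w : forall i, bcomul HU (x (GenW i)) = tens (x (GenW i)) (x (GenW i))).
Hypotheses (comul_w' : forall i, bcomul HU (x (GenW' i)) = tens (x (GenW' i)) (x (GenW' i))).
Hypotheses (comul_e : forall i,
  bcomul HU (x (GenE i)) = tens (x (GenE i)) (1 : U) + tens (x (GenW i)) (x (GenE i))).
Hypotheses (comul_f : forall i,
  bcomul HU (x (GenF i)) = tens (1 : U) (x (GenF i)) + tens (x (GenF i)) (x (GenW' i))).
Hypotheses (counit_w : forall i, bcounit HU (x (GenW i)) = 1).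
Hypotheses (counit_w' : forall i, bcounit HU (x (GenW' i)) = 1).
Hypotheses (counit_e : forall i, bcounit HU (x (GenE i)) = 0).
Hypotheses (counit_f : forall i, bcounit HU (x (GenF i)) = 0).
Hypotheses (antipode_f : forall i,
  antipode HU (x (GenF i)) = - (x (GenF i) * x (GenW'inv i))).

Hypotheses (pp : hopf_pairing (coop HB') HB p).
Hypotheses (p_f_e : forall i j, p (fB i) (eB j) = (i == j)%:R / (s - r)).
Hypotheses (p_w'_w : forall i j, p (w'B i) (wB j) = r ^ Defs.form i j * s ^ (- Defs.form j i)).
Hypotheses (p_f_w : forall i j, p (fB i) (wB j) = 0).
Hypotheses (p_w'_e : forall i j, p (w'B i) (eB j) = 0).

Hypotheses (r_neq0 : r != 0) (s_neq0 : s != 0).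
Hypotheses (B_gen : forall b,
  subalg (fun b => [\/ exists i, b = eB i, exists i, b = wB i | exists i, b = wVB i]) b).
Hypotheses (B'_gen : forall f,
  subalg (fun f => [\/ exists i, f = fB i, exists i, f = w'B i | exists i, f = w'VB i]) f).
Hypotheses (U_gen : forall u, subalg (fun u => exists g, u = x g) u).
Hypotheses (U_universal : forall (A : algType K) (y : gen -> A),
  (forall a b, Urs_rel r s y a b -> a = b) ->
  exists phi : U -> A, [/\ linear phi, monoid_morphism phi & forall g, phi (x g) = y g]).

Let Hh := hopf_on_is_hopf HB.
Let Hh' := hopf_on_is_hopf HB'.
Let HhU := hopf_on_is_hopf HU.
Let Hb := hopf_is_bialgebra Hh.
Let Hb' := hopf_is_bialgebra Hh'.
Let HbU := hopf_is_bialgebra HhU.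
Let mE := hopf_on_mul HB.
Let mE' := hopf_on_mul HB'.
Let mEU := hopf_on_mul HU.
Let oE := hopf_on_one HB.
Let oE' := hopf_on_one HB'.
Let oEU := hopf_on_one HU.

Let vBl : linear vB := hopf_mor_linear HB_sub.
Let vB'l : linear vB' := hopf_mor_linear HB'_sub.
Let vB1 : vB 1 = 1. Proof. by rewrite -oE (hopf_mor1 HB_sub). Qed.
Let vB'1 : vB' 1 = 1. Proof. by rewrite -oE' (hopf_mor1 HB'_sub). Qed.
Let vBM a b : vB (a * b) = vB a * vB b.
Proof. by rewrite -mE (hopf_morM HB_sub) mEU. Qed.
Let vB'M a b : vB' (a * b) = vB' a * vB' b.
Proof. by rewrite -mE' (hopf_morM HB'_sub) mEU. Qed.
Let p_bil : is_bilinear p := pairing_bilinear pp.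
#[local] Hint Resolve p_bil : lin.

Let tmapD (A A' C C' : lmodType K) (f : A -> A') (g : C -> C') t u :
  linear f -> linear g -> tmap f g (t + u) = tmap f g t + tmap f g u.
Proof. by move=> fl gl; rewrite /tmap linrD //; lin. Qed.

Let tmap_tens (A A' C C' : lmodType K) (f : A -> A') (g : C -> C') a c :
  linear f -> linear g -> tmap f g (tens a c) = tens (f a) (g c).
Proof. by move=> fl gl; rewrite /tmap tlift_tens //; lin. Qed.

Lemma bcomul_eB i : bcomul HB (eB i) = tens (eB i) (1 : B) + tens (wB i) (eB i).
Proof.
apply: (tmap_inj vBl vB_inj); rewrite -(hopf_mor_comul HB_sub) tmapD // !tmap_tens //.
by rewrite ?vB1 ?vB_e ?vB_w; exact: comul_e.
Qed.

Lemma bcomul_wB i : bcomul HB (wB i) = tens (wB i) (wB i).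
Proof.
apply: (tmap_inj vBl vB_inj); rewrite -(hopf_mor_comul HB_sub) !tmap_tens //.
by rewrite vB_w; exact: comul_w.
Qed.

Lemma bcomul_fB i : bcomul HB' (fB i) = tens (1 : B') (fB i) + tens (fB i) (w'B i).
Proof.
apply: (tmap_inj vB'l vB'_inj); rewrite -(hopf_mor_comul HB'_sub) tmapD // !tmap_tens //.
by rewrite ?vB'1 ?vB'_f ?vB'_w'; exact: comul_f.
Qed.

Lemma bcomul_w'B i : bcomul HB' (w'B i) = tens (w'B i) (w'B i).
Proof.
apply: (tmap_inj vB'l vB'_inj); rewrite -(hopf_mor_comul HB'_sub) !tmap_tens //.
by rewrite vB'_w'; exact: comul_w'.
Qed.

Lemma bcounit_eB i : bcounit HB (eB i) = 0.
Proof. by rewrite -(hopf_mor_counit HB_sub) vB_e; exact: counit_e. Qed.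

Lemma bcounit_wB i : bcounit HB (wB i) = 1.
Proof. by rewrite -(hopf_mor_counit HB_sub) vB_w; exact: counit_w. Qed.

Lemma bcounit_fB i : bcounit HB' (fB i) = 0.
Proof. by rewrite -(hopf_mor_counit HB'_sub) vB'_f; exact: counit_f. Qed.

Lemma bcounit_w'B i : bcounit HB' (w'B i) = 1.
Proof. by rewrite -(hopf_mor_counit HB'_sub) vB'_w'; exact: counit_w'. Qed.

Lemma w'B_w'VB i : w'B i * w'VB i = 1.
Proof.
by apply: vB'_inj; rewrite vB'M vB'1 vB'_w' vB'_w'V; apply: x_rel (rel_w'_w'V _ _ _ _).
Qed.

Lemma w'VB_w'B i : w'VB i * w'B i = 1.
Proof.
by apply: vB'_inj; rewrite vB'M vB'1 vB'_w' vB'_w'V; apply: x_rel (rel_w'V_w' _ _ _ _).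
Qed.

Lemma bcounit_w'VB i : bcounit HB' (w'VB i) = 1.
Proof.
have := bcounitM Hb' (w'VB i) (w'B i).
by rewrite mE' w'VB_w'B -oE' (bcounit1 Hb') bcounit_w'B mulr1.
Qed.

Lemma antipode_w'B i : antipode HB' (w'B i) = w'VB i.
Proof.
have := antipodel Hh' (w'B i); rewrite bcomul_w'B tlift_tens; last by lin.
rewrite mE' bcounit_w'B scale1r oE' => h.
by rewrite -[LHS]mulr1 -(w'B_w'VB i) mulrA h mul1r.
Qed.

Lemma antipode_fB i : antipode HB' (fB i) = - (fB i * w'VB i).
Proof.
apply: vB'_inj; rewrite (hopf_mor_antipode HB'_sub) (linrN vB'l) vB'M vB'_f vB'_w'V.
exact: antipode_f.
Qed.

Let p1r f : p f 1 = bcounit HB' f.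
Proof. by rewrite -oE (pairing1r pp). Qed.

Let p1l b : p 1 b = bcounit HB b.
Proof. by rewrite -oE' (pairing1l pp). Qed.

Lemma pairing_w'VB_e i j : p (w'VB i) (eB j) = 0.
Proof.
have := pairing_mull pp (w'VB i) (w'B i) (eB j).
rewrite mE' w'VB_w'B p1l bcounit_eB bcomul_eB tliftD; last by lin.
rewrite !tlift_tens; try by lin.
by rewrite p_w'_e mulr0 addr0 p1r bcounit_w'B mulr1 => <-.
Qed.

Lemma pairing_w'VB_w i j : p (w'VB i) (wB j) * p (w'B i) (wB j) = 1.
Proof.
have := pairing_mull pp (w'VB i) (w'B i) (wB j).
rewrite mE' w'VB_w'B p1l bcounit_wB bcomul_wB.
by rewrite tlift_tens //; lin.
Qed.

Lemma pairing_antipode_f_w i j : p (antipode HB' (fB i)) (wB j) = 0.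
Proof.
rewrite antipode_fB (linrN (p_bil.1 _)) -mE' (pairing_mull pp) bcomul_wB.
rewrite tlift_tens; last by lin.
by rewrite p_f_w mul0r oppr0.
Qed.

Lemma pairing_antipode_f_e i j : p (antipode HB' (fB i)) (eB j) = - p (fB i) (eB j).
Proof.
rewrite antipode_fB (linrN (p_bil.1 _)) -mE' (pairing_mull pp) bcomul_eB tliftD; last by lin.
rewrite !tlift_tens; try by lin.
by rewrite pairing_w'VB_e mulr0 addr0 p1r bcounit_w'VB mulr1.
Qed.

Local Notation ad := (adact HB HB' p).
Let ad_tri : is_trilinear ad := adact_trilinear Hh Hh' pp.
Let adE := adactE Hh Hh' pp.
#[local] Hint Resolve ad_tri : lin.

Let ad_w f f' j : ad f f' (wB j) = (p (antipode HB' f) (wB j) * p f' (wB j) : K) *: wB j.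
Proof.
rewrite adE bcomul_wB tlift_tens; last by lin.
by rewrite bcomul_wB tlift_tens //; lin.
Qed.

Let ad_e f f' j : ad f f' (eB j) =
  (p (antipode HB' f) (eB j) * bcounit HB' f' : K) *: 1 +
  (p (antipode HB' f) (wB j) * bcounit HB' f' : K) *: eB j +
  (p (antipode HB' f) (wB j) * p f' (eB j) : K) *: wB j.
Proof.
rewrite adE bcomul_eB tliftD; last by lin.
rewrite !tlift_tens; try by lin.
rewrite bcomul_eB bcomul_wB tliftD; last by lin.
rewrite !tlift_tens; try by lin.
by rewrite !p1r.
Qed.

Local Notation A := (double_alg Hh Hh' pp).
Let inl (a : B) : A := tens a (1 : B').
Let inr (f : B') : A := tens (1 : B) f.

Let inl_mul_tens a b g : inl a * (tens b g : A) = tens (a * b) g.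
Proof. by rewrite double_alg_mul /inl -oE' (double_mul_inl Hh Hh' pp) mE. Qed.

Let tens_mul_inr a f g : (tens a f : A) * inr g = tens a (f * g).
Proof. by rewrite double_alg_mul /inr -oE (double_mul_inr Hh Hh' pp) mE'. Qed.

Let inlM a b : inl (a * b) = inl a * inl b. Proof. by rewrite inl_mul_tens. Qed.
Let inrM f g : inr (f * g) = inr f * inr g. Proof. by rewrite tens_mul_inr. Qed.
Let inl_inr a f : inl a * inr f = tens a f. Proof. by rewrite inl_mul_tens mulr1. Qed.
Let inl1 : inl 1 = 1. Proof. by rewrite /inl -oE -oE'. Qed.
Let inr1 : inr 1 = 1. Proof. by rewrite /inr -oE -oE'. Qed.
Let inl_lin : linear inl. Proof. exact: (tens_bilinear _ _).1. Qed.
Let inr_lin : linear inr. Proof. exact: (tens_bilinear _ _).2. Qed.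

Let inr_inl f b : inr f * inl b =
  sw HB' f (fun u f3 => sw HB' u (fun f1 f2 => tens (ad f1 f3 b) f2)) :> A.
Proof.
rewrite double_alg_mul /inl /inr (double_mul_tens Hh Hh' pp).
apply: eq_tlift => u f3; apply: eq_tlift => f1 f2.
by rewrite mE mE' mul1r mulr1.
Qed.

Let inr_w'_inl i b : inr (w'B i) * inl b = tens (ad (w'B i) (w'B i) b) (w'B i) :> A.
Proof.
rewrite inr_inl bcomul_w'B tlift_tens; last by lin.
by rewrite bcomul_w'B tlift_tens //; lin.
Qed.

Let inr_f_inl i b : inr (fB i) * inl b = tens (ad 1 (fB i) b) 1 +
  (tens (ad 1 (w'B i) b) (fB i) + tens (ad (fB i) (w'B i) b) (w'B i)) :> A.
Proof.
rewrite inr_inl bcomul_fB tliftD; last by lin.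
rewrite !tlift_tens; try by lin.
rewrite bcomul_fB tliftD; last by lin.
rewrite !tlift_tens; try by lin.
by rewrite -[in X in X + _]oE' (sw_one Hb') ?oE' //; lin.
Qed.

Let w'_w i j : inr (w'B i) * inl (wB j) = inl (wB j) * inr (w'B i).
Proof.
by rewrite inr_w'_inl ad_w antipode_w'B pairing_w'VB_w scale1r inl_inr.
Qed.

Let tensZ c a f : tens (c *: a) f = c *: (inl a * inr f) :> A.
Proof. by rewrite inl_inr; apply: linrZ ((tens_bilinear _ _).1 f) _ _. Qed.

Let S1 : antipode HB' 1 = 1.
Proof. by rewrite -oE' (antipode1 Hh'). Qed.

Let w'_e i j : inr (w'B i) * inl (eB j) =
  (r ^ (- Defs.form i j) * s ^ Defs.form j i) *: (inl (eB j) * inr (w'B i)).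
Proof.
rewrite inr_w'_inl ad_e antipode_w'B pairing_w'VB_e p_w'_e mul0r mulr0 !scale0r add0r addr0.
rewrite tensZ bcounit_w'B mulr1; congr (_ *: _).
have /mulr1_eq := pairing_w'VB_w i j; rewrite p_w'_w => /(canRL invrK) ->.
by rewrite invfM !invr_expz opprK.
Qed.

Let f_w i j : inr (fB i) * inl (wB j) =
  (r ^ Defs.form i j * s ^ (- Defs.form j i)) *: (inl (wB j) * inr (fB i)).
Proof.
have -> : inr (fB i) * inl (wB j) =
    tens ((p 1 (wB j) * p (w'B i) (wB j) : K) *: wB j) (fB i).
  rewrite inr_f_inl !ad_w p_f_w pairing_antipode_f_w mulr0 mul0r !scale0r S1.
  by rewrite (linr0 ((tens_bilinear _ _).1 _)) add0r (linr0 ((tens_bilinear _ _).1 _)) addr0.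
by rewrite tensZ p1l bcounit_wB mul1r p_w'_w.
Qed.

Let f_e i j : inr (fB i) * inl (eB j) = inl (eB j) * inr (fB i) +
  ((i == j)%:R / (s - r)) *: (inl (wB j) - inr (w'B i)).
Proof.
have -> : inr (fB i) * inl (eB j) = tens ((p (fB i) (eB j) : K) *: wB j) 1 +
    (tens (eB j) (fB i) + tens ((- p (fB i) (eB j) : K) *: 1) (w'B i)).
  rewrite inr_f_inl !ad_e S1 !p1l pairing_antipode_f_w pairing_antipode_f_e.
  rewrite bcounit_eB bcounit_wB bcounit_fB bcounit_w'B p_w'_e.
  by rewrite !(mul0r, mulr0, mul1r, mulr1, scale0r, addr0, add0r, scale1r).
rewrite !tensZ inr1 inl1 mulr1 mul1r -inl_inr p_f_e scalerBr scaleNr addrCA.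
by [].
Qed.

Let w_f i j : inl (wB i) * inr (fB j) =
  (r ^ (- Defs.form j i) * s ^ Defs.form i j) *: (inr (fB j) * inl (wB i)).
Proof.
rewrite f_w scalerA mulrACA -!expfzDr // addNr subrr !expr0z mulr1.
by rewrite scale1r.
Qed.

Let e_f i j : inl (eB i) * inr (fB j) - inr (fB j) * inl (eB i) =
  (i == j)%:R *: ((r - s)^-1 *: (inl (wB i) - inr (w'B i))).
Proof.
rewrite f_e opprD addrA subrr add0r eq_sym -scaleNr scalerA.
have [->|_] := eqVneq i j; last by rewrite !mul0r oppr0 !scale0r.
by rewrite !mul1r -invrN opprB.
Qed.

Let vBm : monoid_morphism vB. Proof. by split. Qed.
Let vB'm : monoid_morphism vB'. Proof. by split. Qed.
Let inlm : monoid_morphism inl. Proof. by split. Qed.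
Let inrm : monoid_morphism inr. Proof. by split. Qed.

Let glue_A := glue inl inr eB wB wVB fB w'B w'VB.

Let glue_A_rel a b : Urs_rel r s glue_A a b -> a = b.
Proof.
exact: (glue_rel vB_inj vB'_inj vBl vBm vB'l vB'm inl_lin inlm inr_lin inrm
  vB_e vB_w vB_wV vB'_f vB'_w' vB'_w'V x_rel w'_w w'_e w_f e_f).
Qed.

Local Notation psi := (tlift (fun a f => vB a * vB' f)).

Let psi_bil : is_bilinear (fun a f => vB a * vB' f).
Proof.
split=> [f|a] c y z.
- by rewrite vBl mulrDl -scalerAl.
- by rewrite vB'l mulrDr -scalerAr.
Qed.
#[local] Hint Resolve psi_bil : lin.

Let psi_surj u : exists t, psi t = u.
Proof.
exact: (triangular_surj vBl vBm vB'l vB'm vB_e vB_w vB_wV vB'_f vB'_w' vB'_w'V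
  x_rel r_neq0 s_neq0 B_gen U_gen).
Qed.

Let double_comul_psi (phi : U -> tensor B B') : linear phi ->
    (forall t, phi (psi t) = t) ->
  forall t, double_comul HB HB' t = tmap phi phi (bcomul HU (psi t)).
Proof.
move=> phil psiK; rewrite /tmap; apply: tens_ext.
- by rewrite /double_comul; lin.
- by lin.
move=> a f; rewrite /double_comul tlift_tens; last by lin.
rewrite tlift_tens // -mEU [RHS](sw_mul HbU); last by lin.
rewrite (hopf_mor_comul HB_sub) [RHS](tlift_tmap vB vB); last by lin.
apply: eq_tlift => a1 a2.
rewrite (hopf_mor_comul HB'_sub) [RHS](tlift_tmap vB' vB'); last by lin.
apply: eq_tlift => f1 f2; rewrite !mEU.
by rewrite -(psiK (tens a1 f1)) -(psiK (tens a2 f2)) !tlift_tens.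
Qed.

Let double_counit_psi t : double_counit HB HB' t = bcounit HU (psi t).
Proof.
move: t; apply: tens_ext; [by rewrite /double_counit; lin | by lin | move=> a f].
rewrite /double_counit tlift_tens; last by lin.
by rewrite tlift_tens // -mEU (bcounitM HbU) (hopf_mor_counit HB_sub) (hopf_mor_counit HB'_sub).
Qed.

Theorem drinfeld_double_iso : exists S_D : tensor B B' -> tensor B B',
  let D := HopfData (drinfeld_double HB HB' p) S_D in is_hopf D /\ hopf_isomorphic HU D.
Proof.
have [phi [phil phim phi_x]] := U_universal glue_A_rel.
have phi_inl b : phi (vB b) = inl b.
  elim: (B_gen b) => {b} [|k a b _ Ea _ Eb|a b _ Ea _ Eb|b [] [i ->]].
  - by rewrite vB1 phim.1 inl1.
  - by rewrite vBl phil inl_lin Ea Eb.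
  - by rewrite vBM phim.2 inlM Ea Eb.
  - by rewrite vB_e phi_x.
  - by rewrite vB_w phi_x.
  - by rewrite vB_wV phi_x.
have phi_inr f : phi (vB' f) = inr f.
  elim: (B'_gen f) => {f} [|k a b _ Ea _ Eb|a b _ Ea _ Eb|b [] [i ->]].
  - by rewrite vB'1 phim.1 inr1.
  - by rewrite vB'l phil inr_lin Ea Eb.
  - by rewrite vB'M phim.2 inrM Ea Eb.
  - by rewrite vB'_f phi_x.
  - by rewrite vB'_w' phi_x.
  - by rewrite vB'_w'V phi_x.
have psiK t : phi (psi t) = t.
  move: t; apply: tens_ext; [by lin | by lin | move=> a f].
  by rewrite tlift_tens // phim.2 phi_inl phi_inr inl_inr.
have phiK u : psi (phi u) = u by have [t <-] := psi_surj u; rewrite psiK.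
exists (phi \o antipode HU \o psi).
apply: (@transport_hopf _ _ _ HU (drinfeld_double HB HB' p) phi psi) => //=.
- by lin.
- by move=> u v; rewrite mEU phim.2.
- by rewrite oEU phim.1 oE oE'.
- by move=> u; rewrite (double_comul_psi phil psiK) phiK.
- by move=> u; rewrite double_counit_psi phiK.
Qed.

End TriangularDecomposition.

(** * The theorem *)

Section Subalgebra.
Variables (K : fieldType) (A : algType K).

Lemma subalg_sub (X Y : A -> Prop) a : (forall x, X x -> Y x) -> subalg X a -> subalg Y a.
Proof.
move=> XY; elim=> [|c x y _ Sx _ Sy|x y _ Sx _ Sy|x Xx].
- exact: subalg1.
- exact: subalg_lin.
- exact: subalgM.
- exact/subalg_gen/XY.
Qed.

Lemma subalg_of_gen (X : A -> Prop) (b : subalg_of X) :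
  subalg (fun b : subalg_of X => X (subalg_val b)) b.
Proof.
have [u ub] : exists u, u = subalg_val b by exists (subalg_val b).
have Xu : subalg X u by rewrite ub; apply/subalgP; case: (b).
elim: Xu b ub => {u} [|c y z Xy IHy Xz IHz|y z Xy IHy Xz IHz|y Xy] b ub.
- by rewrite (_ : b = 1); [exact: subalg1 | apply: val_inj].
- pose y' := SubalgOf (introT (subalgP X y) Xy); pose z' := SubalgOf (introT (subalgP X z) Xz).
  rewrite (_ : b = c *: y' + z'); last by apply: val_inj.
  by apply: subalg_lin; [apply: IHy | apply: IHz].
- pose y' := SubalgOf (introT (subalgP X y) Xy); pose z' := SubalgOf (introT (subalgP X z) Xz).
  rewrite (_ : b = y' * z'); last by apply: val_inj.
  by apply: subalgM; [apply: IHy | apply: IHz].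
- by apply: subalg_gen; rewrite -ub.
Qed.

End Subalgebra.

Section UrsGenerated.
Variables (K : fieldType) (r s : K).
Local Notation pi := (presented_pi (Urs_rel r s (free_gen K)) : _ -> Urs r s).
Local Notation G := (subalg (fun u : Urs r s => exists g, u = Ugen r s g)).

Let piM a b : pi (a * b) = pi a * pi b.
Proof. exact/esym/presented_mul_pi. Qed.

Lemma Urs_generated u : G u.
Proof.
have G0 : G 0.
  have -> : 0 = (-1) *: 1 + 1 :> Urs r s by rewrite scaleN1r addNr.
  by apply: subalg_lin; exact: subalg1.
have [a ->] : exists a, u = pi a := presented_surj u.
rewrite [a]monalgE.
elim: (finmap.enum_fset _) => [|[m] l IHl].
  by rewrite big_nil; have -> : pi 0 = 0 by exact: presented_pi0.
rewrite big_cons.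
have -> : << a@_(FMonom m) *g FMonom m >> = a@_(FMonom m) *: << FMonom m >> :> free_alg K gen.
  by apply/malgP => k; rewrite mcoeffZ !mcoeffU mulrnAr mulr1.
rewrite [pi _]presented_piD [X in X + _]presented_piZ.
apply: subalg_lin; last exact: IHl.
elim: m => [|g m IHm].
  have -> : FMonom [::] = mone :> {fmonom gen} by apply: val_inj; rewrite /= fm1.
  exact: subalg1.
have -> : << FMonom (g :: m) >> = free_gen K g * << FMonom m >> :> free_alg K gen.
  rewrite malgM_def fgmulUU mulr1; congr << _ >>.
  by apply: val_inj; rewrite /= fmM fmU.
rewrite piM; apply: subalgM; last exact: IHm.
apply: subalg_gen.
by exists g.
Qed.

End UrsGenerated.

Section UrsHalves.
Variables (K : fieldType) (r s : K).

Lemma Uge0_generated (b : Uge0 r s) : subalg (fun b : Uge0 r s =>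
  [\/ exists i, b = subalg_mem (Uge0_e r s i), exists i, b = subalg_mem (Uge0_w r s i)
    | exists i, b = subalg_mem (Uge0_wV r s i)]) b.
Proof.
apply: subalg_sub (subalg_of_gen b) => {}b b_gen.
have vI (c : Uge0 r s) : subalg_val b = subalg_val c -> b = c := @val_inj _ _ _ b c.
by inversion b_gen as [i E|i E|i E]; [apply: Or31|apply: Or32|apply: Or33]; exists i; apply: vI.
Qed.

Lemma Ule0_generated (b : Ule0 r s) : subalg (fun b : Ule0 r s =>
  [\/ exists i, b = subalg_mem (Ule0_f r s i), exists i, b = subalg_mem (Ule0_w' r s i)
    | exists i, b = subalg_mem (Ule0_w'V r s i)]) b.
Proof.
apply: subalg_sub (subalg_of_gen b) => {}b b_gen.
have vI (c : Ule0 r s) : subalg_val b = subalg_val c -> b = c := @val_inj _ _ _ b c.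
by inversion b_gen as [i E|i E|i E]; [apply: Or31|apply: Or32|apply: Or33]; exists i; apply: vI.
Qed.

End UrsHalves.

Lemma r_neq0 : r != 0.
Proof. by rewrite /r tofrac_eq0 polyC_eq0 polyX_eq0. Qed.

Lemma s_neq0 : s != 0.
Proof. by rewrite /s tofrac_eq0 polyX_eq0. Qed.

Theorem theorem1p1
    (HU : hopf_on (Urs r s)) (HU_spec : Urs_hopf_spec HU)
    (HB : hopf_on (Uge0 r s)) (HB_sub : hopf_morphism HB HU (@Uge0_val Qrs r s))
    (HB'coop : hopf_on (Ule0 r s))
    (HB'coop_sub : hopf_morphism HB'coop HU (@Ule0_val Qrs r s))
    (p : Ule0 r s -> Uge0 r s -> Qrs^o)
    (p_pairing : hopf_pairing (coop HB'coop) HB p) (p_spec : Urs_pairing_spec p) :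
  exists S_D : tensor (Uge0 r s) (Ule0 r s) -> tensor (Uge0 r s) (Ule0 r s),
    let D := HopfData (drinfeld_double HB HB'coop p) S_D in
    is_hopf D /\ hopf_isomorphic HU D.
Proof.
have vB_inj : injective (@Uge0_val Qrs r s) := val_inj.
have vB'_inj : injective (@Ule0_val Qrs r s) := val_inj.
have := @drinfeld_double_iso Qrs r s (Urs r s) (Uge0 r s) (Ule0 r s) (Ugen r s)
  HU HB HB'coop (@Uge0_val Qrs r s) (@Ule0_val Qrs r s) p
  (fun i => subalg_mem (Uge0_e r s i)) (fun i => subalg_mem (Uge0_w r s i))
  (fun i => subalg_mem (Uge0_wV r s i)) (fun i => subalg_mem (Ule0_f r s i))
  (fun i => subalg_mem (Ule0_w' r s i)) (fun i => subalg_mem (Ule0_w'V r s i))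
  HB_sub HB'coop_sub vB_inj vB'_inj
  (fun=> erefl) (fun=> erefl) (fun=> erefl) (fun=> erefl) (fun=> erefl) (fun=> erefl)
  (@Urs_relP _ r s)
  (comul_w HU_spec) (comul_w' HU_spec) (comul_e HU_spec) (comul_f HU_spec)
  (counit_w HU_spec) (counit_w' HU_spec) (counit_e HU_spec) (counit_f HU_spec)
  (antipode_f HU_spec) p_pairing (pairing_f_e p_spec) (pairing_w'_w p_spec)
  (pairing_f_w p_spec) (pairing_w'_e p_spec) r_neq0 s_neq0
  (@Uge0_generated _ r s) (@Ule0_generated _ r s) (@Urs_generated _ r s)
  (@Urs_universal _ r s).
exact.
Qed.
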